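(* Let $\Omega$ be a compact convex domain in $\mathbf{R}^n$, let $p_1,\dots,p_k$ be distinct points in $\mathbf{R}^n$, and let $\sigma:\Omega\to\mathbf{R}$ be a positive continuous function. For $h\in\mathbf{R}^k$ let $u_h(x)=\max_{1\le i\le k}\{x\cdot p_i+h_i\}$ and $W_i(h)=\{x\in\mathbf{R}^n : x\cdot p_i+h_i\ge x\cdot p_j+h_j \text{ for all } j\}$. Then for any $A_1,\dots,A_k>0$ with $\sum_{i=1}^k A_i=\int_\Omega\sigma(x)\,dx$: (1) There exists $b=(b_1,\dots,b_k)\in\mathbf{R}^k$, unique up to adding a constant vector $(c,\dots,c)$, such that $\int_{W_i(b)\cap\Omega}\sigma(x)\,dx=A_i$ for all $i=1,\dots,k$. (2) The set $H=\{h\in\mathbf{R}^k : \mathrm{vol}(W_i(h)\cap\Omega)>0\text{ for all } i\}$ is open and convex, the function $$E(h)=\int_a^h\sum_{i=1}^k\Big(\int_{W_i(h)\cap\Omega}\sigma(x)\,dx\Big)\,dh_i-\sum_{i=1}^k h_iA_i$$ is convex on $H$, and the vectors $b$ in (1) are exactly the minimum points of $E$ on $H$. (3) The restriction of $E$ to $H_0=H\cap\{h : \sum_{i=1}^k h_i=0\}$ is strictly convex. (4) For $b$ as in (1), $\nabla u_b$ minimizes the quadratic cost $\int_\Omega|x-T(x)|^2\sigma(x)\,dx$ among all transport maps $T:(\Omega,\sigma\,dx)\to(\mathbf{R}^n,\sum_{i=1}^kA_i\delta_{p_i})$.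
   Context: Here $x\cdot y$ is the dot product, $|x|^2=x\cdot x$, $\mathrm{vol}$ is Lebesgue measure on $\mathbf{R}^n$, and $\delta_p$ is the Dirac measure at $p$. In the definition of $E$, $a\in H$ is a fixed base point and the integral from $a$ to $h$ is the line integral of the differential 1-form $\sum_i\big(\int_{W_i(h)\cap\Omega}\sigma\,dx\big)dh_i$ along any path in $H$ from $a$ to $h$ (this 1-form is closed on $H$, so the integral is independent of the path). A transport map $T:(\Omega,\sigma\,dx)\to(\mathbf{R}^n,\sum_iA_i\delta_{p_i})$ is a measurable map that is measure preserving, i.e. the push-forward of the measure $\sigma\,dx$ under $T$ is $\sum_iA_i\delta_{p_i}$. The map $\nabla u_b$ is defined almost everywhere on $\Omega$. *)

(* Defs.v *)
From HB Require Import structures.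
From mathcomp Require Import all_boot all_order all_algebra.
From mathcomp Require Import all_classical all_reals all_analysis.

Set Implicit Arguments.
Unset Strict Implicit.
Unset Printing Implicit Defensive.

Import Order.TTheory GRing.Theory Num.Theory.
Import numFieldNormedType.Exports.

Local Open Scope classical_set_scope.
Local Open Scope ring_scope.
Local Open Scope convex_scope.

(* R^n is 'rV[R]_n, with the product sigma-algebra, i.e. the sigma-algebra
   generated by the coordinates; it coincides with the Borel sigma-algebra. *)
Section measurable_rV.
Context {R : realType} (n : nat).

Let coords (i : 'I_n) (x : 'rV[R]_n) : measurableTypeR R := x 0 i.

Let rV_set0 : g_sigma_preimage coords set0.
Proof. exact: sigma_algebra0. Qed.

Let rV_setC A : g_sigma_preimage coords A -> g_sigma_preimage coords (~` A).
Proof. exact: sigma_algebraC. Qed.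

Let rV_bigcup (F : _^nat) : (forall i, g_sigma_preimage coords (F i)) ->
  g_sigma_preimage coords (\bigcup_i (F i)).
Proof. exact: sigma_algebra_bigcup. Qed.

HB.instance Definition _ := @isMeasurable.Build default_measure_display
  'rV[R]_n (g_sigma_preimage coords) rV_set0 rV_setC rV_bigcup.

Lemma measurable_coord (i : 'I_n) :
  measurable_fun [set: 'rV[R]_n] (fun x => x 0 i : measurableTypeR R).
Proof.
move=> _ Y mY; rewrite setTI; apply: sub_sigma_algebra => /=.
rewrite -bigcup_seq/=; exists i => /=; first by rewrite mem_index_enum.
by exists Y => //; rewrite setTI.
Qed.

Lemma measurable_fun_rV d (T : measurableType d) (f : T -> 'rV[R]_n) :
  (forall i, measurable_fun [set: T] (fun t => f t 0 i : measurableTypeR R)) ->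
  measurable_fun [set: T] f.
Proof.
move=> mf _ A mA; rewrite setTI.
suff : g_sigma_preimage coords `<=` [set B | measurable (f @^-1` B)] by apply.
apply: smallest_sub.
  split => [|B /= mB|F mF] /=.
  - by rewrite preimage_set0.
  - by rewrite setTD -preimage_setC; exact: measurableC.
  - by rewrite preimage_bigcup; exact: bigcupT_measurable.
move=> B; rewrite -bigcup_seq => -[i _ [Y mY <-]] /=.
by rewrite setTI -[X in measurable X]setTI; exact: (mf i).
Qed.

End measurable_rV.

Section lebesgue_rV.
Context {R : realType}.

Definition cons_rV n (xy : measurableTypeR R * 'rV[R]_n) : 'rV[R]_n.+1 :=
  \row_i if unlift ord0 i is Some j then xy.2 0 j else xy.1.

Definition uncons_rV n (x : 'rV[R]_n.+1) : (measurableTypeR R * 'rV[R]_n)%type :=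
  (x 0 0, \row_i x 0 (lift 0 i)).

Lemma cons_rV0 n xy : @cons_rV n xy 0 0 = xy.1.
Proof. by rewrite mxE unlift_none. Qed.

Lemma cons_rVS n xy i : @cons_rV n xy 0 (lift 0 i) = xy.2 0 i.
Proof. by rewrite mxE liftK. Qed.

Lemma cons_rVK n : cancel (@cons_rV n) (@uncons_rV n).
Proof.
move=> [x y]; rewrite /uncons_rV cons_rV0; congr (_, _).
by apply/rowP => i; rewrite mxE cons_rVS.
Qed.

Lemma measurable_cons_rV n : measurable_fun setT (@cons_rV n).
Proof.
apply: measurable_fun_rV => i; case: (unliftP 0 i) => [j ->|->].
  under eq_fun do rewrite cons_rVS.
  exact: (measurableT_comp (measurable_coord j) measurable_snd).
by under eq_fun do rewrite cons_rV0; exact: measurable_fst.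
Qed.

Lemma measurable_uncons_rV n : measurable_fun setT (@uncons_rV n).
Proof.
apply/measurable_fun_pairP; split; first exact: measurable_coord.
apply: measurable_fun_rV => i /=.
by under eq_fun do rewrite mxE; exact: measurable_coord.
Qed.

Section step.
Variables (n : nat) (mu : {sigma_finite_measure set 'rV[R]_n -> \bar R}).

Definition lebesgue_cons : set 'rV[R]_n.+1 -> \bar R :=
  pushforward (lebesgue_measure \x mu)%E (@cons_rV n).

Let lebesgue_cons0 : lebesgue_cons set0 = 0%E.
Proof. by rewrite /lebesgue_cons /pushforward preimage_set0 measure0. Qed.

Let lebesgue_cons_ge0 A : (0 <= lebesgue_cons A)%E.
Proof. by rewrite /lebesgue_cons /pushforward; exact: measure_ge0. Qed.

Let lebesgue_cons_semi_sigma_additive : semi_sigma_additive lebesgue_cons.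
Proof.
move=> F mF tF mUF; rewrite /lebesgue_cons /pushforward preimage_bigcup.
have mcons A : measurable A -> measurable (@cons_rV n @^-1` A).
  by move=> mA; rewrite -[X in measurable X]setTI; exact: measurable_cons_rV.
apply: measure_semi_sigma_additive => //.
- by move=> k; exact: mcons.
- apply/trivIsetP => /= i j _ _ ij; rewrite -preimage_setI.
  by move/trivIsetP : tF => /(_ _ _ _ _ ij) ->//; rewrite preimage_set0.
- by rewrite -preimage_bigcup; exact: mcons.
Qed.

HB.instance Definition _ := isMeasure.Build _ _ _ lebesgue_cons
  lebesgue_cons0 lebesgue_cons_ge0 lebesgue_cons_semi_sigma_additive.

Let lebesgue_cons_sigma_finite : sigma_finite setT lebesgue_cons.
Proof.
have [F TF mF] : sigma_finite setT (lebesgue_measure \x mu)%E.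
  have /sigma_finiteP[F [TF ndF Foo]] := sigma_finiteT (@lebesgue_measure R).
  have /sigma_finiteP[G [TG ndG Goo]] := sigma_finiteT mu.
  exists (fun k => F k `*` G k).
    rewrite -setXTT TF TG; apply/seteqP; split=> [[x y]|[x y]].
      move=> [/= [j _ Fjx] [l _ Gly]]; exists (maxn j l) => //; split.
      - by move: x Fjx; exact/subsetPset/ndF/leq_maxl.
      - by move: y Gly; exact/subsetPset/ndG/leq_maxr.
    by move=> [j _ []/= ? ?]; split; exists j.
  move=> k; have [? ?] := Foo k; have [? ?] := Goo k.
  split; first exact: measurableX.
  by rewrite product_measure1E// lte_mul_pinfty// ge0_fin_numE.
exists (fun k => @uncons_rV n @^-1` F k).
  by rewrite -preimage_bigcup -TF preimage_setT.
move=> k; have [mFk Fkoo] := mF k; split.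
  by rewrite -[X in measurable X]setTI; exact: measurable_uncons_rV.
rewrite /lebesgue_cons /pushforward -comp_preimage.
by rewrite (_ : _ \o _ = id) //; apply/funext => x; exact: cons_rVK.
Qed.

HB.instance Definition _ := Measure_isSigmaFinite.Build _ _ _ lebesgue_cons
  lebesgue_cons_sigma_finite.

End step.

(* Lebesgue measure on R^n, the n-fold product of Lebesgue measure on R. *)
Fixpoint lebesgue_rV (n : nat) : {sigma_finite_measure set 'rV[R]_n -> \bar R} :=
  match n with
  | 0 => dirac (0 : 'rV[R]_0)
  | m.+1 => lebesgue_cons (lebesgue_rV m)
  end.

Lemma measurable_box n (B : 'I_n -> set (measurableTypeR R)) :
  (forall i, measurable (B i)) ->
  measurable [set x : 'rV[R]_n | forall i, B i (x 0 i)].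
Proof.
move=> mB; rewrite (_ : mkset _ = \bigcap_(i in [set: 'I_n])
    (fun x : 'rV[R]_n => x 0 i : measurableTypeR R) @^-1` B i).
  apply: fin_bigcap_measurable => // i _.
  by rewrite -[X in measurable X]setTI; exact: measurable_coord.
by apply/seteqP; split=> x /= Bx i; [move=> _|]; exact: Bx.
Qed.

Lemma lebesgue_rV_box n (B : 'I_n -> set (measurableTypeR R)) :
  (forall i, measurable (B i)) ->
  lebesgue_rV n [set x | forall i, B i (x 0 i)] =
  (\prod_(i < n) lebesgue_measure (B i))%E.
Proof.
elim: n B => [|n IHn] B mB.
  by rewrite big_ord0 /= diracE mem_set //= => -[].
have mB' : measurable [set y : 'rV[R]_n | forall i, B (lift 0 i) (y 0 i)].
  by apply: (@measurable_box _ (fun i => B (lift 0 i))) => i; exact: mB.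
rewrite big_ord_recl -IHn // -product_measure1E //.
rewrite /= /lebesgue_cons /pushforward; congr product_measure1.
apply/seteqP; split=> [[x y] /= Bxy|[x y] /= [Bx By] i].
  split; first by have := Bxy 0; rewrite cons_rV0.
  by move=> i; have := Bxy (lift 0 i); rewrite cons_rVS.
by case: (unliftP 0 i) => [j ->|->]; rewrite ?cons_rVS ?cons_rV0 //; exact: By.
Qed.

End lebesgue_rV.

Section dot_gradient.
Context {R : realType} {n : nat}.

(* The Euclidean structure is introduced through dot: the library norm on
   'rV[R]_n is the sup norm. *)
Definition dot (x y : 'rV[R]_n) : R := \sum_(i < n) x 0 i * y 0 i.

Definition sqnorm (x : 'rV[R]_n) : R := dot x x.

(* Represents the differential 'd f x with respect to dot; meaningful where f
   is differentiable. *)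
Definition gradient (f : 'rV[R]_n -> R) (x : 'rV[R]_n) : 'rV[R]_n :=
  \row_i 'd f x (delta_mx 0 i).

(* The form is \sum_i w_i dh_i, given by the vector of its coefficients. *)
Definition line_integral (w : 'rV[R]_n -> 'rV[R]_n) (g : R -> 'rV[R]_n) : R :=
  \int[lebesgue_measure]_(t in `[0, 1]%classic) dot (w (g t)) (derive1 g t).

Definition C1_path_in (D : set 'rV[R]_n) (a b : 'rV[R]_n) (g : R -> 'rV[R]_n) :=
  [/\ g 0 = a, g 1 = b,
      forall t, t \in `[0, 1] -> D (g t) /\ derivable g t 1 &
      {within `[0, 1], continuous (derive1 g)}].

Definition segment_path (a b : 'rV[R]_n) (t : R) : 'rV[R]_n := a + t *: (b - a).

End dot_gradient.

Definition strictly_convex_function (R : numFieldType) (E : lmodType R)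
    (E' := convex_lmodType E) (D : set E') (f : E' -> R^o) :=
  forall t : {i01 R}, 0 < t%:num -> t%:num < 1 ->
    {in D &, forall x y : E', x != y ->
      f (x <| t |> y) < f x <| t |> f y}.

Section cells.
Context {R : realType} {n k : nat}.
Variables (Omega : set 'rV[R]_n) (sigma : 'rV[R]_n -> R).
Variables (p : 'I_k.+1 -> 'rV[R]_n) (A : 'I_k.+1 -> R).
Implicit Types (h b : 'rV[R]_k.+1) (x : 'rV[R]_n).

Definition max_affine h x : R :=
  \big[Num.max/dot x (p 0) + h 0 0]_(i < k.+1) (dot x (p i) + h 0 i).

Definition cell h (i : 'I_k.+1) : set 'rV[R]_n :=
  [set x | forall j, dot x (p i) + h 0 i >= dot x (p j) + h 0 j].

Definition cell_mass h (i : 'I_k.+1) : R :=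
  \int[lebesgue_rV n]_(x in cell h i `&` Omega) sigma x.

Definition fits_masses h := forall i, cell_mass h i = A i.

Definition admissible : set 'rV[R]_k.+1 :=
  [set h | forall i, (0 < lebesgue_rV n (cell h i `&` Omega))%E].

Definition mass_form h : 'rV[R]_k.+1 := \row_i cell_mass h i.

(* Among the paths from a to h in the convex set admissible, we pick the
   segment. *)
Definition energy (a h : 'rV[R]_k.+1) : R :=
  line_integral mass_form (segment_path a h) - \sum_i h 0 i * A i.

Definition transport_map (T : 'rV[R]_n -> 'rV[R]_n) :=
  measurable_fun Omega T /\
  forall B : set 'rV[R]_n, measurable B ->
    (\int[lebesgue_rV n]_(x in Omega `&` T @^-1` B) (sigma x)%:E =
     \sum_i (A i)%:E * \d_(p i) B)%E.

Definition quadratic_cost (T : 'rV[R]_n -> 'rV[R]_n) : \bar R :=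
  (\int[lebesgue_rV n]_(x in Omega) (sqnorm (x - T x) * sigma x)%:E)%E.

End cells.

(* Main.v *)
Require Import Defs.
From HB Require Import structures.
From mathcomp Require Import all_boot all_order all_algebra.
From mathcomp Require Import all_classical all_reals all_analysis.
From mathcomp Require Import measurable_realfun.
From mathcomp Require Import ring lra.

Set Implicit Arguments.
Unset Strict Implicit.
Unset Printing Implicit Defensive.

Import Order.TTheory GRing.Theory Num.Theory.
Import numFieldNormedType.Exports.

Local Open Scope classical_set_scope.
Local Open Scope ring_scope.

(** Everything rests on the potential F h = \int_Omega u_h sigma, where u_h is
    the maximum of the affine functions x.p_i + h_i.

    The subgradient inequality.  At a point x of the open cell where i alone
    achieves u_h, u_h' x >= x.p_i + h'_i = u_h x + (h'_i - h_i).  The walls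
    between the cells lie in finitely many hyperplanes, because the p_i are
    distinct, and hyperplanes are null; integrating, F h' >= F h + m(h).(h' - h)
    where m(h) is the vector of the cell masses ([potential_subgradient]).  The
    map m is continuous ([grad_continuous]), so this inequality, used with base
    h and with base h', squeezes the difference quotients of F: F is C1 with
    gradient m.  Hence the integral of the mass form along any C1 path is the
    increment of F ([line_integral_mass_form]), and E a is, up to a constant,
    the function G h = F h - \sum_i h_i A_i ([energyE]).  This G is convex on
    the whole space, and its critical points are the vectors that fit the
    masses ([dual_functional], [fits_dual_min], [local_min_fits]).

    Existence.  G is unchanged by adding a constant to all the h_i, since the
    A_i add up to the total mass, and it grows at least linearly with
    max h - min h ([dual_lower_bound]).  So it has a minimum, namely one on a
    large cube.

    Strictness.  Let every cell of h have positive mass, and let equality hold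
    in the subgradient inequality for h and h'.  Then each cell of h is
    contained, within Omega, in the cell of h' with the same index, so that
    u_h' - u_h takes finitely many values on the connected set Omega: it is
    constant, and h' - h is a constant vector ([common_cells],
    [potential_strict_subgradient]).  Uniqueness of b up to constants and strict
    convexity on the hyperplane \sum_i h_i = 0 both follow.  The set H consists
    of the h such that Omega meets every open cell ([admissibleP]), which makes
    it visibly open and convex.

    Optimality.  For all x and i,
      |x - p_i|^2 >= |x|^2 - 2 u_b x + |p_i|^2 + 2 b_i,
    with equality when x is in the cell i of b.  For x distributed according
    to sigma and p_i = T x, the integral of the right-hand side is the same for
    all transport maps T, as it only involves the masses A_i
    ([Rintegral_cost_minorant]); and grad u_b achieves equality
    ([gradient_cost]). *)

(** * Lebesgue measure on row vectors *)

Section lebesgue_rV_facts.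
Context {R : realType}.

Lemma ball_rVE n (x : 'rV[R]_n) (e : R) : 0 < e ->
  ball x e = [set y : 'rV[R]_n | forall i, ball (x 0 i) e (y 0 i)].
Proof.
move=> e0; apply/seteqP; split=> y /=; first by case=> _ + i; apply.
by move=> xy; split=> // i j; rewrite ord1.
Qed.

Lemma measurable_ball_rV n (x : 'rV[R]_n) (e : R) : measurable (ball x e).
Proof.
have [e0|e0] := ltP 0 e; last first.
  (* A ball of the space of matrices is empty unless its radius is positive. *)
  rewrite (_ : ball _ _ = set0) //; apply/seteqP; split=> // y [].
  by rewrite ltNge e0.
rewrite ball_rVE //.
apply: (@measurable_box _ n (fun i => ball (x 0 i) e)) => i.
exact: open_measurable (ball_open _ _).
Qed.

(** The sigma-algebra is generated by the coordinates; an open set belongs to it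
    as the countable union of the rational balls that it contains. *)
Lemma open_measurable_rV n (A : set 'rV[R]_n) : open A -> measurable A.
Proof.
move=> oA.
pose c (q : 'rV[rat]_n) : 'rV[R]_n := map_mx ratr q.
pose B (qm : 'rV[rat]_n * nat) := ball (c qm.1) (qm.2.+1%:R^-1 : R).
have -> : A = \bigcup_(qm in [set qm | B qm `<=` A]) B qm.
  apply/seteqP; split=> [x Ax|x [qm /= + ?]]; last exact.
  move: oA; rewrite openE => /(_ _ Ax) /nbhs_ballP[e /= e0 xeA].
  have [m me] : exists m : nat, m.+1%:R^-1 < e / 2.
    exists (Num.truncn (e / 2)^-1).
    by rewrite invf_plt ?posrE ?divr_gt0 //; exact: truncnS_gt.
  have : 0 < (m.+1%:R^-1 : R) by rewrite invr_gt0.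
  move rE : (m.+1%:R^-1 : R) me => r re r0.
  have qP i : exists q : rat, ball (x 0 i) r (ratr q : R).
    have /rat_in_itvoo[q] : x 0 i - r < x 0 i + r by lra.
    rewrite in_itv /= => /andP[q1 q2]; exists q.
    by rewrite /ball /= ltr_norml; apply/andP; split; lra.
  pose q : 'rV[rat]_n := \row_i sval (cid (qP i)).
  have xq : ball x r (c q).
    by rewrite ball_rVE // => i; rewrite /= !mxE; case: cid.
  exists (q, m); rewrite /B /= rE; last exact: ball_sym.
  move=> y /= qy; apply: xeA; apply: (@le_ball _ _ _ (r + r)); first by lra.
  exact: ball_triangle xq qy.
rewrite bigcup_mkcond; apply: countable_bigcupT_measurable => // qm.
by case: ifP => // _; exact: measurable_ball_rV.
Qed.

Lemma closed_measurable_rV n (A : set 'rV[R]_n) : closed A -> measurable A.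
Proof. by move/closed_openC/open_measurable_rV/measurableC; rewrite setCK. Qed.

Lemma open_measurable_subspace_rV n (D : set 'rV[R]_n) (U : set (subspace D)) :
  measurable D -> open U -> measurable (D `&` U).
Proof.
move=> mD /open_subspaceP [V oV VD]; rewrite setIC -VD.
by apply: measurableI => //; exact: open_measurable_rV.
Qed.

Lemma within_continuous_measurable_fun_rV n (D : set 'rV[R]_n)
    (f : 'rV[R]_n -> R) :
  measurable D -> {within D, continuous f} ->
  measurable_fun D (f : 'rV[R]_n -> measurableTypeR R).
Proof.
move=> mD /continuousP cf; apply: (measurability _ (RGenOpens.measurableE R)).
move=> _ [_ [a [b ->] <-]]; apply: open_measurable_subspace_rV => //.
exact/cf/interval_open.
Qed.

Lemma lebesgue_rV_ball_gt0 n (x : 'rV[R]_n) (e : R) : 0 < e ->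
  (0 < lebesgue_rV n (ball x e))%E.
Proof.
move=> e0; rewrite ball_rVE //.
rewrite (lebesgue_rV_box (B := fun i => ball (x 0 i) e)); last first.
  by move=> i; exact: open_measurable (ball_open _ _).
elim/big_ind : _ => // [u v u0 v0|i _]; first exact: mule_gt0.
by rewrite lebesgue_measure_ball ?ltW // lte_fin mulrn_wgt0.
Qed.

Lemma lebesgue_rV_ball_lty n (x : 'rV[R]_n) (e : R) :
  (lebesgue_rV n (ball x e) < +oo)%E.
Proof.
have [e0|e0] := ltP 0 e; last first.
  rewrite (_ : ball _ _ = set0) ?measure0 //.
  by apply/seteqP; split=> // y []; rewrite ltNge e0.
rewrite ball_rVE //.
rewrite (lebesgue_rV_box (B := fun i => ball (x 0 i) e)); last first.
  by move=> i; exact: open_measurable (ball_open _ _).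
under eq_bigr do rewrite lebesgue_measure_ball ?ltW //.
by rewrite prodEFin ltry.
Qed.

Lemma compact_lebesgue_rV_lty n (K : set 'rV[R]_n) : compact K ->
  (lebesgue_rV n K < +oo)%E.
Proof.
move=> cK; have /ex_strict_bound_gt0[M M0 /= KM] : bounded_set K.
  exact: compact_bounded.
apply: le_lt_trans (lebesgue_rV_ball_lty 0 M).
apply: le_measure.
- rewrite inE; apply: closed_measurable_rV; apply: compact_closed => //.
- by rewrite inE; exact: measurable_ball_rV.
- by move=> x Kx; rewrite -ball_normE /= sub0r normrN; exact: KM.
Qed.

End lebesgue_rV_facts.
(** * Dot product and hyperplanes *)
Section dot_theory.
Context {R : realType} {n : nat}.
Implicit Types x y v : 'rV[R]_n.

Lemma dotC x y : dot x y = dot y x.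
Proof. by apply: eq_bigr => i _; rewrite mulrC. Qed.

Lemma dotDl x y v : dot (x + y) v = dot x v + dot y v.
Proof. by rewrite -big_split /=; apply: eq_bigr => i _; rewrite mxE mulrDl. Qed.

Lemma dotZl (t : R) x v : dot (t *: x) v = t * dot x v.
Proof. by rewrite big_distrr /=; apply: eq_bigr => i _; rewrite mxE mulrA. Qed.

Lemma dotNl x v : dot (- x) v = - dot x v.
Proof. by rewrite -scaleN1r dotZl mulN1r. Qed.

Lemma dotBl x y v : dot (x - y) v = dot x v - dot y v.
Proof. by rewrite dotDl dotNl. Qed.

Lemma dotZr (t : R) x v : dot v (t *: x) = t * dot v x.
Proof. by rewrite !(dotC v) dotZl. Qed.

Lemma dotNr x v : dot v (- x) = - dot v x.
Proof. by rewrite !(dotC v) dotNl. Qed.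

Lemma dotBr x y v : dot v (x - y) = dot v x - dot v y.
Proof. by rewrite !(dotC v) dotBl. Qed.

Lemma dot0l v : dot 0 v = 0.
Proof. by rewrite -(scale0r 0) dotZl mul0r. Qed.

Lemma dot0r v : dot v 0 = 0.
Proof. by rewrite dotC dot0l. Qed.

Lemma dot_delta x (i : 'I_n) : dot (delta_mx 0 i) x = x 0 i.
Proof.
rewrite /dot (bigD1 i) //= big1 ?addr0 => [|j ji].
  by rewrite mxE !eqxx mul1r.
by rewrite mxE (negbTE ji) mul0r.
Qed.

Lemma dot_cvg {T : Type} {F : set_system T} {FF : Filter F}
    (f g : T -> 'rV[R]_n) (x y : 'rV[R]_n) :
  f @ F --> x -> g @ F --> y -> dot (f t) (g t) @[t --> F] --> dot x y.
Proof.
move=> fx gy; apply: cvg_big => [|i _]; first exact: add_continuous.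
have coord (h : T -> 'rV[R]_n) (z : 'rV[R]_n) :
    h @ F --> z -> h t 0 i @[t --> F] --> z 0 i.
  exact: (continuous_cvg _ (@coord_continuous _ _ _ 0 i z)).
by apply: cvgM; exact: coord.
Qed.

Lemma dot_continuous v : continuous (fun x => dot x v).
Proof.
move=> x; apply: (@dot_cvg _ (nbhs x) _ id (fun=> v)) => /=.
  exact: cvg_id.
exact: cvg_cst.
Qed.

Lemma sqnorm_continuous : continuous (@sqnorm R n).
Proof. by move=> x; exact: (@dot_cvg _ (nbhs x) _ id id x x cvg_id cvg_id). Qed.

End dot_theory.

(** By Fubini, slicing along the first coordinate: a slice is a hyperplane of
    one dimension less, unless v is proportional to the first basis vector, in
    which case the hyperplane is the product of a point and the whole space. *)
Lemma hyperplane_null {R : realType} n (v : 'rV[R]_n) (c : R) : v != 0 ->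
  lebesgue_rV n [set x | dot x v = c] = 0%E.
Proof.
elim: n v c => [|n IHn] v c v0.
  by case/eqP: v0; apply/rowP => -[].
rewrite /= /lebesgue_cons /pushforward.
pose v' : 'rV[R]_n := \row_i v 0 (lift 0 i).
have dotE (xy : measurableTypeR R * 'rV[R]_n) :
    dot (cons_rV xy) v = xy.1 * v 0 0 + dot xy.2 v'.
  rewrite /dot big_ord_recl cons_rV0; congr (_ + _).
  by apply: eq_bigr => i _; rewrite cons_rVS mxE.
have [v'0|v'0] := eqVneq v' 0.
  have v00 : v 0 0 != 0.
    apply: contra v0 => /eqP v00; apply/eqP/rowP => i; rewrite mxE.
    case: (unliftP 0 i) => [j ->|->//].
    by have /rowP/(_ j) := v'0; rewrite !mxE.
  rewrite (_ : _ @^-1` _ = [set c / v 0 0] `*` setT).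
    have m1 := @measurable_set1 R (c / v 0 0).
    have -> := product_measure1E lebesgue_measure (lebesgue_rV n)
      m1 measurableT.
    rewrite -[RHS](mul0e (lebesgue_rV n setT)).
    by rewrite -(lebesgue_measure_set1 (c / v 0 0)).
  apply/seteqP; split=> [[x y]|[x y]] /=.
    rewrite dotE /= v'0 dot0r addr0 => <-.
    by split => //; rewrite mulfK.
  by move=> [-> _]; rewrite dotE /= v'0 dot0r addr0 divfK.
rewrite /product_measure1 /= integral0_eq // => x _ /=.
rewrite (_ : xsection _ _ = [set y | dot y v' = c - x * v 0 0]).
  exact: IHn.
apply/seteqP; split => [y|y]; rewrite /xsection /= inE /= dotE /=.
  by move=> <-; rewrite addrAC subrr add0r.
by move=> ->; rewrite addrC subrK.
Qed.

Lemma rV_cvg {R : realType} {T : Type} {F : set_system T} {FF : Filter F}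
    {m : nat} (f : T -> 'rV[R]_m) (z : 'rV[R]_m) :
  (forall i, f t 0 i @[t --> F] --> z 0 i) -> f @ F --> z.
Proof.
move=> fz; apply/cvg_ballP => e e0.
have : \forall t \near F, forall i, ball (z 0 i) e (f t 0 i).
  apply: (@filter_forall _ _ (fun i t => ball (z 0 i) e (f t 0 i)) F _) => i.
  by have /cvg_ballP/(_ e e0) := fz i.
by apply: filterS => t ft; rewrite ball_rVE.
Qed.

Lemma derivable1_continuous {R : realType} (V : normedModType R) (g : R -> V)
    (t : R) :
  derivable g t 1 -> {for t, continuous g}.
Proof.
move=> dg.
have H : differentiable (g : R^o -> V) t by exact: (derivable1_diffP _ _).1 dg.
exact: (differentiable_continuous H).
Qed.

(** * Real integrals and sign almost everywhere *)
Section Rintegral_ae.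
Context d (T : measurableType d) (R : realType).
Variable mu : {measure set T -> \bar R}.
Implicit Types (D N B : set T) (f : T -> R).

Lemma Rintegral_sum (I : Type) (s : seq I) D (f : I -> T -> R) :
  measurable D -> (forall i, mu.-integrable D (EFin \o f i)) ->
  \int[mu]_(x in D) (\sum_(i <- s) f i x) =
  \sum_(i <- s) \int[mu]_(x in D) f i x.
Proof.
move=> mD intf; elim: s => [|i s IHs].
  under eq_Rintegral do rewrite big_nil.
  by rewrite Rintegral_cst // mul0r big_nil.
under eq_Rintegral do rewrite big_cons.
rewrite big_cons RintegralD // ?IHs //.
rewrite (_ : _ \o _ = fun x => (\sum_(j <- s) (f j x)%:E)%E).
  by apply: integrable_sum => // j _; exact: intf.
by apply/funext => x /=; rewrite sumEFin.
Qed.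

Lemma integrable_indicM D B f : measurable D -> measurable B ->
  mu.-integrable D (EFin \o f) -> mu.-integrable D (EFin \o (\1_B \* f)).
Proof.
move=> mD mB intf; have mf := measurable_int mu intf.
apply: le_integrable intf => //.
  apply/measurable_EFinP; apply: measurable_funM; first exact: measurable_indic.
  by apply/measurable_EFinP; exact: mf.
move=> x Dx /=; rewrite lee_fin normrM ler_piMl //.
by rewrite indicE; case: (x \in B); rewrite ?normr1 ?normr0.
Qed.

Lemma Rintegral_setI_indic D B f : 
  \int[mu]_(x in B `&` D) f x = \int[mu]_(x in D) (\1_B x * f x).
Proof.
rewrite Rintegral_mkcondl; apply: eq_Rintegral => x _.
by rewrite patchE indicE; case: (x \in B); rewrite ?mul1r ?mul0r.
Qed.

Lemma ae_Rintegral_ge0 D f : measurable D -> mu.-integrable D (EFin \o f) ->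
  {ae mu, forall x, D x -> 0 <= f x} -> 0 <= \int[mu]_(x in D) f x.
Proof.
move=> mD intf [N [mN N0 fN]]; rewrite /Rintegral (negligible_integral mN) //.
apply/fine_ge0/integral_ge0 => x [Dx Nx]; rewrite lee_fin.
by apply: contrapT => fx; apply: Nx; apply: fN => /(_ Dx).
Qed.

Lemma ae_eq_Rintegral D f g : measurable D ->
  mu.-integrable D (EFin \o f) -> mu.-integrable D (EFin \o g) ->
  {ae mu, forall x, D x -> f x = g x} ->
  \int[mu]_(x in D) f x = \int[mu]_(x in D) g x.
Proof.
move=> mD intf intg fg; congr fine; apply: ae_eq_integral => //.
- by case/integrableP: intf.
- by case/integrableP: intg.
- by apply: filterS fg => x fgx Dx /=; rewrite fgx.
Qed.

Lemma ae_Rintegral_gt0 D B f : measurable D -> mu.-integrable D (EFin \o f) ->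
  {ae mu, forall x, D x -> 0 <= f x} ->
  measurable B -> B `<=` D -> (0 < mu B)%E ->
  {ae mu, forall x, B x -> 0 < f x} ->
  0 < \int[mu]_(x in D) f x.
Proof.
move=> mD intf f0 mB BD B0 fB.
rewrite lt_neqAle (ae_Rintegral_ge0 mD) // andbT; apply/eqP => int0.
have [+ _] := ae_eq_integral_abs mu mD (measurable_int mu intf).
case=> [|M [mM M0 fM]].
  transitivity (\int[mu]_(x in D) (f x)%:E)%E.
    apply: ae_eq_integral => //.
    - by apply: measurableT_comp => //; by case/integrableP: intf.
    - by case/integrableP: intf.
    - by apply: filterS f0 => x f0 Dx; rewrite gee0_abs // lee_fin f0.
  by rewrite -[LHS]fineK ?integrable_fin_num // -/(Rintegral _ _ _) -int0.
case: fB => N [mN N0 fN].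
move: B0; rewrite ltNge => /negP; apply; apply: (@le_trans _ _ (mu (N `|` M))).
  apply: le_measure; rewrite ?inE //; first exact: measurableU.
  move=> x Bx; have [fx|fx] := ltP 0 (f x); [right|left].
    by apply: fM => /= /(_ (BD _ Bx)) [fx0]; rewrite fx0 ltxx in fx.
  by apply: fN => /= /(_ Bx); rewrite ltNge fx.
apply: (le_trans (measureU2 _ mN mM)).
by rewrite -[leRHS]adde0; apply: leeD; rewrite le_eqVlt; apply/orP; left;
  apply/eqP; [exact: N0|exact: M0].
Qed.

End Rintegral_ae.
(** * Cells of a maximum of affine functions *)
Section cells_geometry.
Context {R : realType} {n k : nat} (p : 'I_k.+1 -> 'rV[R]_n).
Implicit Types (h : 'rV[R]_k.+1) (x : 'rV[R]_n) (i j : 'I_k.+1).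

(** With strict inequalities the cells are disjoint, and open both in x and in
    h; for distinct p_i, they cover almost everything. *)
Definition strict_cell h i : set 'rV[R]_n :=
  [set x | forall j, j != i -> dot x (p j) + h 0 j < dot x (p i) + h 0 i].

Lemma le_max_affine h x i : dot x (p i) + h 0 i <= max_affine p h x.
Proof. exact: (le_bigmax _ (fun i => dot x (p i) + h 0 i)). Qed.

Lemma cellP h i x : cell p h i x <-> max_affine p h x = dot x (p i) + h 0 i.
Proof.
split=> [xi|xi j]; last by rewrite -xi; exact: le_max_affine.
by apply/le_anti; rewrite le_max_affine andbT; apply: bigmax_le.
Qed.

Lemma cell_cover h x : exists i, cell p h i x.
Proof.
have [i _ xi] := @arg_maxP _ _ _ 0 predT (fun i => dot x (p i) + h 0 i) erefl.
by exists i => j; exact: xi.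
Qed.

Lemma strict_cellW h i : strict_cell h i `<=` cell p h i.
Proof. by move=> x xi j; have [->|/xi/ltW] := eqVneq j i. Qed.

Lemma strict_cell_uniq h i j x : strict_cell h i x -> cell p h j x -> j = i.
Proof.
by move=> xi xj; apply: contrapT => /eqP /xi; rewrite ltNge xj.
Qed.

Lemma affine_continuous (c : R) (v : 'rV[R]_n) :
  continuous (fun x => dot x v + c).
Proof. by move=> x; exact: (cvgD (@dot_continuous _ _ v x) (cvg_cst c)). Qed.

Lemma max_affine_continuous h : continuous (max_affine p h).
Proof.
rewrite /max_affine; elim: (index_enum _) => [|i s IHs].
  by under eq_fun do rewrite big_nil; exact: affine_continuous.
under eq_fun do rewrite big_cons.
exact: (max_fun_continuous (@affine_continuous (h 0 i) (p i)) IHs).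
Qed.

Lemma cell_closed h i : closed (cell p h i).
Proof.
rewrite (_ : cell p h i = \bigcap_j
  (fun x => dot x (p i - p j) + (h 0 i - h 0 j)) @^-1` [set y | 0 <= y]).
  apply: closed_bigI => j _.
  apply: closed_comp => [x _|]; last exact: closed_ge.
  exact: affine_continuous.
apply/seteqP; split=> x /= xi j.
  by move=> _; have := xi j; rewrite /= dotBr; lra.
by have := xi j I; rewrite /= dotBr; lra.
Qed.

Lemma strict_cell_open h i : open (strict_cell h i).
Proof.
rewrite openE => x xi; rewrite /interior.
have : \forall y \near x, forall j,
    j != i -> 0 < dot y (p i - p j) + (h 0 i - h 0 j).
  apply: (@filter_forall _ _ (fun j (y : 'rV[R]_n) =>
    j != i -> 0 < dot y (p i - p j) + (h 0 i - h 0 j)) (nbhs x) _) => j.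
  have [->|ji] := eqVneq j i; first exact: filterE.
  have cxj := @affine_continuous (h 0 i - h 0 j) (p i - p j) x.
  have : \forall y \near x, 0 < dot y (p i - p j) + (h 0 i - h 0 j).
    apply: (cvgr_gt _ cxj); have := xi j ji; rewrite dotBr; lra.
  by apply: filterS.
by apply: filterS => y yi j /yi; rewrite dotBr; lra.
Qed.

Lemma measurable_cell h i : measurable (cell p h i).
Proof. by apply: closed_measurable_rV; exact: cell_closed. Qed.

Lemma measurable_strict_cell h i : measurable (strict_cell h i).
Proof. by apply: open_measurable_rV; exact: strict_cell_open. Qed.

Hypothesis p_inj : injective p.

(** A point of no open cell lies on one of the hyperplanes
    x.(p_i - p_j) = h_j - h_i, and p_i - p_j is not zero. *)
Lemma ae_strict_cell h :
  {ae lebesgue_rV n, forall x, exists i, strict_cell h i x}.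
Proof.
have : {ae lebesgue_rV n, forall x, forall ij : 'I_k.+1 * 'I_k.+1,
    ij.1 != ij.2 ->
    dot x (p ij.1) + h 0 ij.1 <> dot x (p ij.2) + h 0 ij.2}.
  apply: (@filter_forall _ _ (fun ij (x : 'rV[R]_n) => ij.1 != ij.2 ->
    dot x (p ij.1) + h 0 ij.1 <> dot x (p ij.2) + h 0 ij.2) _ _) => -[i j] /=.
  have [->|ij] := eqVneq i j; first exact: filterE.
  exists [set x | dot x (p i - p j) = h 0 j - h 0 i]; split.
  - apply: closed_measurable_rV; apply: (@closed_comp _ _ _ [set y | y = _]).
      by move=> x _; exact: dot_continuous.
    exact: closed_eq.
  - by apply: hyperplane_null; rewrite subr_eq0 (inj_eq p_inj).
  - by move=> x /= /not_implyP[_ /contrapT]; rewrite dotBr; lra.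
apply: filterS => x xP; have [i xi] := cell_cover h x; exists i => j ji.
by rewrite lt_neqAle xi andbT; apply/eqP; exact: (xP (j, i)).
Qed.

End cells_geometry.
(** * Gradients of maxima of affine functions *)
Section gradient_theory.
Context {R : realType} {n : nat}.
Implicit Types (f : 'rV[R]_n -> R) (x v : 'rV[R]_n).

Lemma near_affine_is_diff f x v (c : R) :
  (\forall y \near x, f y = dot y v + c) ->
  is_diff x f (fun y => dot y v).
Proof.
move=> fx.
have lin : linear (fun y => dot y v).
  by move=> t y z; rewrite dotDl dotZl.
pose lm := GRing.isLinear.Build R 'rV[R]_n R^o _ (fun y => dot y v) lin.
pose df : {linear 'rV[R]_n -> R^o} := HB.pack (fun y => dot y v) lm.
have cdf : continuous df by exact: dot_continuous.
have fE : (f : 'rV[R]_n -> R^o) \o shift x =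
    cst (f x) + df +o_ (0 : 'rV[R]_n) id.
  apply/eqaddoP => e e0.
  have sx : (y + x) @[y --> (0 : 'rV[R]_n)] --> x.
    have := cvgD (@cvg_id _ (nbhs (0 : 'rV[R]_n))) (cvg_cst x).
    by rewrite add0r; exact.
  have : \forall y \near (0 : 'rV[R]_n), f (y + x) = dot (y + x) v + c.
    exact: (sx _ fx).
  apply: filterS => y fy.
  rewrite -![(_ + _ : _ -> _) _]/(_ + _) /= -![(- _ : _ -> _) _]/(- _) /=.
  rewrite -![(_ + _ : _ -> _) _]/(_ + _) /= fy (nbhs_singleton fx) dotDl.
  rewrite [X in `|X|](_ : _ = 0) ?normr0 ?mulr_ge0 // ?ltW //.
  by rewrite /cst; ring.
have dE := diff_unique cdf fE.
by apply: DiffDef => //; apply/diff_locallyP; split; rewrite dE.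
Qed.

Lemma gradientE f x v : is_diff x f (fun y => dot y v) -> gradient f x = v.
Proof.
by move=> dfx; apply/rowP => i; rewrite mxE diff_val dot_delta.
Qed.

(** The differential is chosen among the maps that satisfy its defining
    property; when there is none, the choice is a default linear map that
    depends neither on the function nor on the point. *)
Lemma gradient_nondifferentiable : exists q : 'rV[R]_n,
  forall f x, ~ differentiable f x -> gradient f x = q.
Proof.
exists (\row_i (point : {linear 'rV[R]_n -> R^o}) (delta_mx 0 i)) => f x ndf.
apply/rowP => i; rewrite !mxE /diff; set P := (X in get X).
rewrite getPN // => df dfP; apply: ndf; apply/diffP; exact: (@getI _ P df dfP).
Qed.

(** Along w the difference quotients from the right are at least w.v, hence so
    is the differential; apply this to w and to - w. *)
Lemma supporting_diff f x v : differentiable f x ->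
  (forall y, f x + dot (y - x) v <= f y) -> gradient f x = v.
Proof.
move=> dfx fv.
have le_d w : dot w v <= 'd f x w.
  rewrite -deriveE //.
  have dfw : derivable f x w by exact: diff_derivable.
  have /cvg_dnbhs_at_right dfwr :
    s^-1 *: (f (s *: w + x) - f x) @[s --> (0 : R)^'] --> 'D_w f x := dfw.
  apply: (cvgr_to_ge dfwr); near=> s.
  have s0 : 0 < s by near: s; exact: nbhs_right_gt.
  rewrite -(ler_pM2l s0) [_ *: _]/(_ * _) mulrA mulfV ?gt_eqF // mul1r -dotZl.
  by have := fv (s *: w + x); rewrite addrK; lra.
apply/rowP => i; rewrite mxE -(dot_delta v i).
apply/le_anti; rewrite le_d andbT.
by have := le_d (- delta_mx 0 i); rewrite linearN dotNl lerN2.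
Unshelve. all: by end_near. Qed.

End gradient_theory.

Section gradient_max_affine.
Context {R : realType} {n k : nat} (p : 'I_k.+1 -> 'rV[R]_n).
Implicit Types (h : 'rV[R]_k.+1) (x : 'rV[R]_n) (i : 'I_k.+1).

Lemma max_affine_is_diff h i x : strict_cell p h i x ->
  is_diff x (max_affine p h) (fun y => dot y (p i)).
Proof.
move=> xi; apply: (@near_affine_is_diff _ _ _ _ _ (h 0 i)).
have : \forall y \near x, strict_cell p h i y.
  by apply: open_nbhs_nbhs; split => //; exact: strict_cell_open.
by apply: filterS => y yi; apply/cellP; exact: strict_cellW.
Qed.

Lemma gradient_strict_cell h i x : strict_cell p h i x ->
  gradient (max_affine p h) x = p i.
Proof. by move=> xi; apply: gradientE; exact: max_affine_is_diff. Qed.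

Hypothesis p_inj : injective p.

(** If u_h is differentiable at x, each affine function active at x supports u_h
    there, so its slope is the gradient; distinct slopes leave room for only one
    of them. *)
Lemma max_affine_nondifferentiable h x : (forall i, ~ strict_cell p h i x) ->
  ~ differentiable (max_affine p h) x.
Proof.
move=> tie dx.
have grad_cell i : cell p h i x -> gradient (max_affine p h) x = p i.
  move=> xi; apply: supporting_diff => // y.
  rewrite (cellP p h i x).1 // dotBl.
  by have := le_max_affine p h y i; lra.
have [i xi] := cell_cover p h x; apply: (tie i) => j ji.
rewrite lt_neqAle xi andbT; apply: contra ji => /eqP xij.
apply/eqP/p_inj; rewrite -grad_cell; last by move=> l; rewrite xij.
exact: grad_cell.
Qed.

(** The gradient is measurable for the Borel sets and not just up to null sets:
    it equals p_i on the open cell i and one default value q on the walls. *)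
Lemma measurable_gradient_max_affine h :
  measurable_fun setT (gradient (max_affine p h)).
Proof.
have [q gradq] := @gradient_nondifferentiable R n.
move=> _ B mB; rewrite setTI.
pose S := \bigcup_(i in [set: 'I_k.+1]) strict_cell p h i.
have mS : measurable S.
  by apply: fin_bigcup_measurable => // i _; exact: measurable_strict_cell.
rewrite (_ : _ @^-1` B =
    (\bigcup_(i in [set i | B (p i)]) strict_cell p h i) `|`
    ([set _ | B q] `&` ~` S)).
  apply: measurableU.
    by apply: fin_bigcup_measurable => // i _; exact: measurable_strict_cell.
  apply: measurableI; last exact: measurableC.
  have [Bq|nBq] := pselect (B q).
    by rewrite (_ : mkset _ = setT) //; apply/seteqP; split.
  by rewrite (_ : mkset _ = set0) //; apply/seteqP; split.
have gradS x : ~ S x -> gradient (max_affine p h) x = q.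
  move=> Sx; apply/gradq/max_affine_nondifferentiable => i xi.
  by apply: Sx; exists i.
apply/seteqP; split=> x /=.
  have [[i _ xi]|Sx] := pselect (S x).
    by rewrite (gradient_strict_cell xi) => Bi; left; exists i.
  by rewrite gradS // => Bq; right.
case=> [[i /= Bi xi]|[+ Sx]]; first by rewrite (gradient_strict_cell xi).
by rewrite gradS.
Qed.

End gradient_max_affine.

(** * Connectedness, sequences and null sets *)
Lemma convex_set_comb {R : realType} (V : lmodType R) (D : set V) (x y : V)
    (t : R) :
  convex_set D -> D x -> D y -> 0 <= t <= 1 -> D (t *: x + (1 - t) *: y).
Proof.
move=> cD Dx Dy /andP[t0 t1].
by have := cD x y (Itv01 t0 t1) (mem_set Dx) (mem_set Dy); rewrite inE.
Qed.

Lemma ae_ex d (T : measurableType d) (R : realType)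
    (nu : {measure set T -> \bar R}) (P : T -> Prop) (B : set T) :
  measurable B -> (0 < nu B)%E -> {ae nu, forall x, P x} ->
  exists2 x, B x & P x.
Proof.
move=> mB B0 [N [mN N0 PN]]; apply: contrapT => noP; move: B0.
rewrite -N0 ltNge le_measure ?inE // => x Bx.
by apply: PN => /= Px; apply: noP; exists x.
Qed.

(** By the intermediate value theorem the range contains the segment between the
    two end values; a finite set contains no segment of positive length. *)
Lemma continuous_finite_range {R : realType} (f : R -> R) (s : seq R) :
  {within `[0, 1], continuous f} -> (forall t, t \in `[0, 1] -> f t \in s) ->
  f 0 = f 1.
Proof.
move=> cf fs.
have sub : [set` `[Num.min (f 0) (f 1), Num.max (f 0) (f 1)]] `<=` [set` s].
  move=> v /=; rewrite in_itv /= => vf.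
  by have [//|c c01 <-] := IVT _ cf vf; exact: fs.
have /countable_lebesgue_measure0 :
    countable [set` `[Num.min (f 0) (f 1), Num.max (f 0) (f 1)]].
  apply: sub_countable (finite_set_countable (finite_seq s)).
  exact: subset_card_le.
rewrite lebesgue_measure_itv /= lte_fin.
case: ltP => [lt01|le01 _].
  rewrite -EFinD => -[] /eqP; rewrite subr_eq0 => /eqP E.
  by rewrite E ltxx in lt01.
by move: le01; rewrite /Num.min /Num.max; case: ltgtP; lra.
Qed.

(** The dominated convergence theorem speaks of sequences; this turns its
    conclusion into continuity. *)
Lemma cvg_seq_continuous {R : realType} {V : normedModType R} (f : V -> R)
    (a : V) :
  (forall u : nat -> V, u @ \oo --> a -> f (u m) @[m --> \oo] --> f a) ->
  {for a, continuous f}.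
Proof.
move=> fseq; apply/cvgrPdist_lt => e e0.
apply: contrapT => ne.
have bad (m : nat) : exists y, ball a m.+1%:R^-1 y /\ e <= `|f a - f y|.
  apply: contrapT => /forallNP good; apply: ne.
  apply/nbhs_ballP; exists m.+1%:R^-1 => /=; first by rewrite invr_gt0.
  move=> y ay /=; rewrite ltNge; apply/negP => fy.
  by apply: (good y).
pose u m := sval (cid (bad m)).
have ua : u @ \oo --> a.
  apply/cvg_ballP => r r0; near=> m.
  apply: (@le_ball _ _ _ m.+1%:R^-1); last by rewrite /u; case: cid => y [].
  rewrite -[leRHS]invrK lef_pV2 ?posrE ?invr_gt0 //; apply/ltW.
  apply: (@lt_le_trans _ _ m%:R); last by rewrite ler_nat.
  by near: m; exact: nbhs_infty_gtr.
have /cvgrPdist_lt/(_ e e0)[N _ /(_ N (leqnn N))] := fseq u ua.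
by rewrite /= /u; case: cid => y /= [_]; rewrite leNgt => /negP.
Unshelve. all: by end_near. Qed.

(** * The potential and its subgradient *)
Section potential.
Context {R : realType} {n k : nat}.
Variables (Omega : set 'rV[R]_n) (sigma : 'rV[R]_n -> R).
Variable p : 'I_k.+1 -> 'rV[R]_n.
Hypothesis cO : compact Omega.
Hypothesis p_inj : injective p.
Hypothesis csigma : {within Omega, continuous sigma}.
Hypothesis sigma_gt0 : forall x, Omega x -> 0 < sigma x.
Implicit Types (h : 'rV[R]_k.+1) (x : 'rV[R]_n) (i j : 'I_k.+1).

Local Notation mu := (lebesgue_rV n).
Local Notation mass := (cell_mass Omega sigma p).
Local Notation grad := (mass_form Omega sigma p).

Let mO : measurable Omega.
Proof. by apply: closed_measurable_rV; apply: compact_closed. Qed.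

Lemma compact_integrable_rV (f : 'rV[R]_n -> R) :
  {within Omega, continuous f} ->
  mu.-integrable Omega (EFin \o f).
Proof.
move=> cf; apply: measurable_bounded_integrable => //.
- exact: compact_lebesgue_rV_lty.
- exact: within_continuous_measurable_fun_rV.
- have : bounded_set (f @` Omega) by apply/compact_bounded/continuous_compact.
  move=> [M [Mreal fM]]; exists M; split=> // N MN x Ox /=.
  by apply: (fM N MN (f x)); exists x.
Qed.

Lemma integrable_density (f : 'rV[R]_n -> R) : continuous f ->
  mu.-integrable Omega (EFin \o (f \* sigma)).
Proof.
move=> cf; apply: compact_integrable_rV.
have cfO : {within Omega, continuous f} by exact: continuous_subspaceT.
by move=> x; apply: cvgM; [exact: cfO|exact: csigma].
Qed.

Lemma integrable_sigma : mu.-integrable Omega (EFin \o sigma).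
Proof. exact: compact_integrable_rV. Qed.

Lemma integrable_cell_density h i (c : R) :
  mu.-integrable Omega (EFin \o (fun x => (\1_(cell p h i) x * c) * sigma x)).
Proof.
have := integrable_indicM mO (measurable_cell p h i) integrable_sigma.
move=> /(integrableZl mO c); apply: eq_integrable => // x _ /=.
by rewrite -EFinM; congr EFin; ring.
Qed.

Lemma cell_massE h i :
  mass h i = \int[mu]_(x in Omega) (\1_(cell p h i) x * sigma x).
Proof. exact: Rintegral_setI_indic. Qed.

Definition potential h : R :=
  \int[mu]_(x in Omega) (max_affine p h x * sigma x).

(** The integrand of the remainder F h' - F h - m(h).(h' - h). *)
Definition gap h h' x : R := max_affine p h' x - max_affine p h x
  - \sum_i \1_(cell p h i) x * (h' - h) 0 i.

Lemma gap_strict_cell h h' i x : strict_cell p h i x ->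
  gap h h' x = max_affine p h' x - (dot x (p i) + h' 0 i).
Proof.
move=> xi; rewrite /gap (cellP p h i x).1; last exact: strict_cellW.
rewrite (bigD1 i) //= big1 ?addr0 => [|j ji].
  by rewrite indicE mem_set ?mul1r; [rewrite !mxE; lra|exact: strict_cellW].
rewrite indicE memNset ?mul0r //.
by move=> xj; move/eqP: ji; apply; exact: strict_cell_uniq xj.
Qed.

Lemma ae_gap_ge0 h h' : {ae mu, forall x, 0 <= gap h h' x}.
Proof.
apply: filterS (ae_strict_cell p_inj h) => x [i xi].
by rewrite (gap_strict_cell h' xi) subr_ge0 le_max_affine.
Qed.

Lemma gap_split h h' x : gap h h' x * sigma x =
  max_affine p h' x * sigma x - max_affine p h x * sigma x
  - \sum_i (\1_(cell p h i) x * (h' - h) 0 i) * sigma x.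
Proof. by rewrite /gap !mulrBl big_distrl. Qed.

Let int_max h := integrable_density (@max_affine_continuous _ _ _ p h).

Let int_cells h (d : 'rV[R]_k.+1) : mu.-integrable Omega
  (EFin \o (fun x => \sum_i (\1_(cell p h i) x * d 0 i) * sigma x)).
Proof.
rewrite (_ : _ \o _ =
  fun x => (\sum_i ((\1_(cell p h i) x * d 0 i) * sigma x)%:E)%E).
  by apply: integrable_sum => // i _; exact: integrable_cell_density.
by apply/funext => x /=; rewrite sumEFin.
Qed.

Lemma integrable_gap h h' :
  mu.-integrable Omega (EFin \o (gap h h' \* sigma)).
Proof.
rewrite (_ : _ \o _ = fun x =>
    ((max_affine p h' x * sigma x)%:E - (max_affine p h x * sigma x)%:E
    - (\sum_i (\1_(cell p h i) x * (h' - h) 0 i) * sigma x)%:E)%E); last first.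
  by apply/funext => x /=; rewrite gap_split !EFinB.
apply: integrableB => //; last exact: int_cells.
by apply: integrableB => //; exact: int_max.
Qed.

Lemma potential_gap h h' :
  potential h' - potential h - dot (grad h) (h' - h) =
  \int[mu]_(x in Omega) (gap h h' x * sigma x).
Proof.
under eq_Rintegral do rewrite gap_split.
have intB : mu.-integrable Omega (EFin \o (fun x =>
    max_affine p h' x * sigma x - max_affine p h x * sigma x)).
  have := integrableB mO (int_max h') (int_max h); exact: eq_integrable.
rewrite (RintegralB mO intB (int_cells h (h' - h))).
rewrite (RintegralB mO (int_max h') (int_max h)).
congr (_ - _); rewrite Rintegral_sum //; last first.
  by move=> i; exact: integrable_cell_density.
apply: eq_bigr => i _; rewrite mxE cell_massE -RintegralZr //; last first.
  exact: integrable_indicM mO (measurable_cell p h i) integrable_sigma.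
by apply: eq_Rintegral => x _; ring.
Qed.

Lemma potential_subgradient h h' :
  potential h + dot (grad h) (h' - h) <= potential h'.
Proof.
suff : 0 <= potential h' - potential h - dot (grad h) (h' - h) by lra.
rewrite potential_gap; apply: ae_Rintegral_ge0 => //.
  exact: integrable_gap.
apply: filterS (ae_gap_ge0 h h') => x gx Ox.
by rewrite mulr_ge0 // ltW // sigma_gt0.
Qed.

(** * Differentiability of the potential *)
Lemma strict_cell_near h i x : strict_cell p h i x ->
  \forall h' \near h, strict_cell p h' i x.
Proof.
move=> xi.
apply: (@filter_forall _ _ (fun j (h' : 'rV[R]_k.+1) => j != i ->
  dot x (p j) + h' 0 j < dot x (p i) + h' 0 i) (nbhs h) _) => j.
have [->|ji] := eqVneq j i; first exact: filterE.
pose f (h' : 'rV[R]_k.+1) := h' 0 i - h' 0 j.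
have fh : f h' @[h' --> h] --> f h.
  exact: (cvgB (@coord_continuous R 1 _ 0 i h) (@coord_continuous R 1 _ 0 j h)).
have : \forall h' \near h, dot x (p j) - dot x (p i) < f h'.
  by apply: (cvgr_gt _ fh); have := xi j ji; rewrite /f; lra.
by apply: filterS => h'; rewrite /f => hh' _; lra.
Qed.

Lemma indic_strict_cell h i j x : strict_cell p h i x ->
  \1_(cell p h j) x = (j == i)%:R :> R.
Proof.
move=> xi; rewrite indicE; have [->|ji] := eqVneq j i.
  by rewrite mem_set //; exact: strict_cellW.
by rewrite memNset // => xj; move/eqP: ji; apply; exact: strict_cell_uniq xj.
Qed.

(** Dominated convergence: a point x of the open cell l of h stays in the cell l
    of all nearby h', so the indicators of the cells at x are locally constant
    at h for almost all x. *)
Lemma cell_mass_continuous i : continuous (fun h => mass h i).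
Proof.
move=> h; apply: cvg_seq_continuous => u uh.
have int_cell h' :=
  integrable_indicM mO (measurable_cell p h' i) integrable_sigma.
have [] := @dominated_convergence _ _ _ mu _ mO
  (fun m x => (\1_(cell p (u m) i) x * sigma x)%:E)
  (fun x => (\1_(cell p h i) x * sigma x)%:E) (EFin \o sigma).
- by move=> m; case/integrableP: (int_cell (u m)).
- by case/integrableP: (int_cell h).
- apply: filterS (ae_strict_cell p_inj h) => x [l xl] Ox.
  apply: (@cvg_near_cst _ _ _ _ _ _).
  have : \forall m \near \oo, strict_cell p (u m) l x.
    exact: (uh _ (strict_cell_near xl)).
  apply: filterS => m xlm.
  by rewrite (indic_strict_cell _ xlm) (indic_strict_cell _ xl).
- exact: integrable_sigma.
- apply: aeW => x m Ox /=; rewrite lee_fin normrM indicE.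
  rewrite (ger0_norm (ltW (sigma_gt0 Ox))) ler_piMl ?(ltW (sigma_gt0 Ox)) //.
  by case: (x \in cell p (u m) i); rewrite ?normr1 ?normr0 ?ler01.
move=> _ _ /= cvg_int.
rewrite cell_massE; under eq_fun do rewrite cell_massE.
apply: fine_cvg; rewrite fineK //.
by apply: integrable_fin_num => //; exact: int_cell.
Qed.

Lemma grad_continuous : continuous grad.
Proof.
move=> h; apply: (@rV_cvg _ _ (nbhs h) _) => i.
rewrite mxE; under eq_fun do rewrite mxE.
exact: cell_mass_continuous.
Qed.

(** With D = g (t + s) - g t, the subgradient inequality at both ends puts the
    increment of F between m(g t).D and m(g (t + s)).D.  Divided by s, both
    bounds tend to m(g t).g'(t); bounding the distance to the first one by their
    difference avoids discussing the sign of s. *)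
Lemma potential_chain (g : R -> 'rV[R]_k.+1) (t : R) : derivable g t 1 ->
  is_derive t 1 (potential \o g) (dot (grad (g t)) (derive1 g t)).
Proof.
move=> dg.
pose q (s : R) := s^-1 *: (g (s *: 1 + t) - g t).
have qcvg : q s @[s --> 0^'] --> derive1 g t.
  by rewrite derive1E; exact: dg.
have gcvg : g (s *: 1 + t) @[s --> 0^'] --> g t.
  have cg : {for t, continuous g}.
    exact: derivable1_continuous.
  apply: continuous_cvg; first exact: cg.
  apply: cvg_within_filter.
  have : s *: (1 : R^o) + t @[s --> (0 : R^o)] --> 0 *: (1 : R^o) + t.
    by apply: cvgD; [apply: cvgZr_tmp; exact: cvg_id|exact: cvg_cst].
  by rewrite scale0r add0r.
pose A s := dot (grad (g t)) (q s).
pose B s := dot (grad (g (s *: 1 + t))) (q s).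
pose L := dot (grad (g t)) (derive1 g t).
have AL : A s @[s --> 0^'] --> L.
  by apply: (dot_cvg (f := fun=> grad (g t)) (g := q)) => //; exact: cvg_cst.
have BL : B s @[s --> 0^'] --> L.
  apply: (dot_cvg (f := fun s => grad (g (s *: 1 + t))) (g := q)) => //.
  by apply: continuous_cvg gcvg; exact: grad_continuous.
have QL : s^-1 *: ((potential \o g) (s *: 1 + t) - (potential \o g) t)
    @[s --> 0^'] --> L.
  have BA0 : `|B s - A s| @[s --> 0^'] --> 0.
    by have := cvg_norm (cvgB BL AL); rewrite subrr normr0; exact.
  apply: (@squeeze_cvgr _ _ _ _ (fun s => A s - `|B s - A s|)
                                 (fun s => A s + `|B s - A s|)).
  - apply: nearW => s /=; rewrite -ler_distl /A /B /q !dotZr -mulrBr.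
    set D := g (s *: 1 + t) - g t.
    have lower : dot (grad (g t)) D <=
        potential (g (s *: 1 + t)) - potential (g t).
      by rewrite lerBrDl; exact: potential_subgradient.
    have upper : potential (g (s *: 1 + t)) - potential (g t)
        <= dot (grad (g (s *: 1 + t))) D.
      rewrite lerBlDr -lerBlDl -dotNr opprB; exact: potential_subgradient.
    rewrite /GRing.scale /= -mulrBr !normrM ler_wpM2l //.
    rewrite !ger0_norm ?subr_ge0 ?lerD2r //; exact: le_trans lower upper.
  - by have := cvgB AL BA0; rewrite subr0; exact.
  - by have := cvgD AL BA0; rewrite addr0; exact.
apply: DeriveDef; first by apply/cvg_ex; exists L.
by rewrite /derive; exact: cvg_lim.
Qed.

Lemma line_integral_mass_form D (a b : 'rV[R]_k.+1) (g : R -> 'rV[R]_k.+1) :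
  C1_path_in D a b g -> line_integral grad g = potential b - potential a.
Proof.
move=> [<- <- gD cg']; rewrite /line_integral.
have dP (t : R) : t \in `[0, 1] ->
    is_derive t 1 (potential \o g) (dot (grad (g t)) (derive1 g t)).
  by move=> t01; apply: potential_chain; have [] := gD t t01.
have cP (t : R) : t \in `[0, 1] -> {for t, continuous (potential \o g)}.
  by move=> /dP dPt; apply: (@derivable1_continuous _ R^o); exact: ex_derive.
rewrite /Rintegral (@continuous_FTC2 _ _ (potential \o g)) //=.
- apply/subspace_continuousP => t t01.
  apply: (dot_cvg (f := grad \o g) (g := derive1 g)).
    apply: cvg_within_filter; apply: continuous_cvg.
      exact: grad_continuous.
    by apply: derivable1_continuous; have [] := gD t t01.
  by move/subspace_continuousP: cg'; apply.
- split.
  + by move=> t t01; apply: ex_derive; apply: dP; exact: subset_itv_oo_cc t01.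
  + by apply: cvg_at_right_filter; apply: cP; rewrite in_itv /= lexx ler01.
  + by apply: cvg_at_left_filter; apply: cP; rewrite in_itv /= lexx ler01.
- move=> t t01; rewrite derive1E; apply: derive_val; apply: dP.
  exact: subset_itv_oo_cc t01.
Qed.

(** * Admissible heights and strict convexity of the potential *)
Hypothesis convO : convex_set Omega.
Hypothesis intO : Omega° !=set0.

(** An open set U that meets a convex body at x, possibly on its boundary, meets
    its interior: with a ball of radius r about x0 in Omega, the ball of radius
    t r about z = t x0 + (1 - t) x is in Omega, and in U when t is small. *)
Lemma open_meets_gt0 (U : set 'rV[R]_n) x : open U -> U x -> Omega x ->
  (0 < mu (U `&` Omega))%E.
Proof.
move=> oU Ux Ox; have [x0] := intO.
rewrite /interior => /nbhs_ballP[r /= r0 x0r].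
have /nbhs_ballP[e /= e0 xe] : nbhs x U by exact: open_nbhs_nbhs.
(* Points of the ball of radius t r about z are within t M of x. *)
pose M := `|x0 - x| + r + 1.
have M1 : 1 <= M by rewrite /M -addrA; have := normr_ge0 (x0 - x); lra.
pose t := Num.min 1 (e / (2 * M)).
have t0 : 0 < t by rewrite lt_min ltr01 divr_gt0 // mulr_gt0; lra.
have t1 : t <= 1 by rewrite ge_min lexx.
have tM : t * M < e.
  have : t <= e / (2 * M) by rewrite ge_min lexx orbT.
  rewrite ler_pdivlMr; lra.
pose z := t *: x0 + (1 - t) *: x.
apply: lt_le_trans (lebesgue_rV_ball_gt0 z (mulr_gt0 t0 r0)) _.
apply: le_measure; rewrite ?inE; first exact: measurable_ball_rV.
  by apply: measurableI => //; exact: open_measurable_rV.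
move=> y; rewrite -ball_normE /= => zy; split.
  apply: xe; rewrite -ball_normE /=.
  have -> : x - y = t *: (x - x0) + (z - y).
    by apply/rowP => i; rewrite /z !mxE; ring.
  apply: le_lt_trans (ler_normD _ _) _; rewrite normrZ gtr0_norm // distrC.
  apply: le_lt_trans tM; rewrite /M !mulrDr mulr1; lra.
pose w := x0 + t^-1 *: (y - z).
have -> : y = t *: w + (1 - t) *: x.
  rewrite /w scalerDr scalerA mulfV ?gt_eqF // scale1r /z.
  by apply/rowP => i; rewrite !mxE; ring.
apply: (convex_set_comb convO) => //; last by rewrite ltW.
apply: x0r; rewrite -ball_normE /= /w opprD addrA subrr add0r normrN normrZ.
rewrite gtr0_norm ?invr_gt0 // distrC.
by rewrite -(ltr_pM2l t0) mulrA mulfV ?gt_eqF // mul1r.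
Qed.

(** Positive measure of the cells becomes an open condition that is compatible
    with convex combinations. *)
Lemma admissibleP h : admissible Omega p h <->
  forall i, exists2 x, Omega x & strict_cell p h i x.
Proof.
split=> [Hh i|Hh i].
  have mcO : measurable (cell p h i `&` Omega).
    by apply: measurableI => //; exact: measurable_cell.
  have [x [xi Ox] [j xj]] := ae_ex mcO (Hh i) (ae_strict_cell p_inj h).
  by exists x => //; rewrite (strict_cell_uniq xj xi).
have [x Ox xi] := Hh i.
apply: lt_le_trans (open_meets_gt0 (@strict_cell_open _ _ _ p h i) xi Ox) _.
apply: le_measure; rewrite ?inE.
- by apply: measurableI => //; exact: measurable_strict_cell.
- by apply: measurableI => //; exact: measurable_cell.
- by apply: setSI; exact: strict_cellW.
Qed.

Lemma admissible_open : open (admissible Omega p).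
Proof.
rewrite openE => h Hh; rewrite /interior.
have : \forall h' \near h, forall i, exists2 x, Omega x & strict_cell p h' i x.
  apply: (@filter_forall _ _ (fun i (h' : 'rV[R]_k.+1) =>
    exists2 x, Omega x & strict_cell p h' i x) (nbhs h) _) => i.
  have [x Ox xi] := (admissibleP h).1 Hh i.
  by apply: filterS (strict_cell_near xi) => h' xi'; exists x.
by apply: filterS => h' H'; apply/admissibleP.
Qed.

Lemma strict_cell_comb h h' i x y (t : R) : 0 < t -> t <= 1 ->
  strict_cell p h i x -> cell p h' i y ->
  strict_cell p (t *: h + (1 - t) *: h') i (t *: x + (1 - t) *: y).
Proof.
move=> t0 t1 xi yi j ji; rewrite !dotDl !dotZl !mxE.
have H1 : t * (dot x (p j) + h 0 j) < t * (dot x (p i) + h 0 i).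
  by rewrite ltr_pM2l //; exact: xi.
have H2 : (1 - t) * (dot y (p j) + h' 0 j) <= (1 - t) * (dot y (p i) + h' 0 i).
  by apply: ler_wpM2l; [rewrite subr_ge0|exact: yi].
by move: H1 H2; rewrite !mulrDr; lra.
Qed.

Lemma admissible_comb h h' (t : R) : 0 < t -> t <= 1 ->
  admissible Omega p h -> admissible Omega p h' ->
  admissible Omega p (t *: h + (1 - t) *: h').
Proof.
move=> t0 t1 /admissibleP Hh /admissibleP Hh'; apply/admissibleP => i.
have [x Ox xi] := Hh i; have [y Oy yi] := Hh' i.
exists (t *: x + (1 - t) *: y).
  by apply: convex_set_comb => //; rewrite t1 ltW.
by apply: strict_cell_comb => //; exact: strict_cellW.
Qed.

Lemma admissible_convex : convex_set (admissible Omega p).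
Proof.
apply/convex_setW => h h' /[!inE] Hh Hh' t t0 t1.
by rewrite inE; exact: (admissible_comb t0 (ltW t1) Hh Hh').
Qed.

(** A point x of the closed cell i is the limit, along a segment, of points of
    the open cell, so the hypothesis extends to closed cells.  Then u_h' - u_h
    equals h'_i - h_i on the cell i of h within Omega, hence takes finitely many
    values on any segment of Omega. *)
Lemma common_cells h h' : admissible Omega p h ->
  (forall i x, Omega x -> strict_cell p h i x -> cell p h' i x) ->
  exists c, h' = h + const_mx c.
Proof.
move=> Hh sub.
have subc i x : Omega x -> cell p h i x -> cell p h' i x.
  move=> Ox xi; have [y Oy yi] := (admissibleP h).1 Hh i.
  pose w (t : R) := t *: y + (1 - t) *: x.
  have wi t : 0 < t -> t <= 1 -> cell p h' i (w t).
    move=> t0 t1; apply: sub.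
      by apply: convex_set_comb => //; rewrite t1 ltW.
    have := strict_cell_comb t0 t1 yi xi.
    by rewrite -scalerDl addrC subrK scale1r.
  (* With a, b the margins of i over j for h' at x, y: if a + e < 0, then a
     point of the segment close to x contradicts wi. *)
  move=> j; rewrite -subr_ge0; apply/ler_addgt0Pl => e e0; rewrite addrC.
  have := sub i y Oy yi j; rewrite -subr_ge0.
  set b := _ - _ => b0; set a := _ - _.
  have [//|ae] := leP 0 (a + e).
  pose t := Num.min 1 (e / (b - a + 1)).
  have t0 : 0 < t by rewrite lt_min ltr01 divr_gt0 //; lra.
  have t1 : t <= 1 by rewrite ge_min lexx.
  have tb : t * (b - a) < e.
    have : t <= e / (b - a + 1) by rewrite ge_min lexx orbT.
    rewrite ler_pdivlMr; lra.
  have := wi t t0 t1 j; rewrite /w !dotDl !dotZl.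
  have : t * (b - a) + a < 0 by lra.
  rewrite /a /b; lra.
pose v x := max_affine p h' x - max_affine p h x.
have vE i x : Omega x -> cell p h i x -> v x = h' 0 i - h 0 i.
  move=> Ox xi; rewrite /v (cellP p h i x).1 // (cellP p h' i x).1.
    lra.
  exact: subc.
have cv : continuous v.
  move=> x.
  exact: (cvgB (@max_affine_continuous _ _ _ p h' x)
               (@max_affine_continuous _ _ _ p h x)).
exists (h' 0 0 - h 0 0); apply/rowP => i; rewrite !mxE.
have [x Ox xi] := (admissibleP h).1 Hh i.
have [y Oy yi] := (admissibleP h).1 Hh 0.
pose f t := v (t *: x + (1 - t) *: y).
suff : f 0 = f 1.
  rewrite /f !scale0r !subr0 !scale1r subrr scale0r add0r addr0.
  by rewrite (vE 0) ?(vE i) //; [lra|exact: strict_cellW|exact: strict_cellW].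
apply: (@continuous_finite_range _ _ [seq h' 0 j - h 0 j | j : 'I_k.+1]).
  apply: continuous_subspaceT => t; rewrite /f.
  apply: continuous_cvg; first exact: cv.
  apply: cvgD; apply: cvgZr_tmp; first exact: cvg_id.
  by apply: cvgB; [exact: cvg_cst|exact: cvg_id].
move=> t; rewrite in_itv /= => t01.
have [j xj] := cell_cover p h (t *: x + (1 - t) *: y).
rewrite /f (vE j) //; first by apply/mapP; exists j => //; rewrite mem_enum.
exact: convex_set_comb.
Qed.

(** By [common_cells], some x of Omega in the open cell i of h has another index
    than i for its maximum with respect to h'.  The integrand [gap] is positive
    near x, and Omega fills a positive part of this neighbourhood. *)
Lemma potential_strict_subgradient h h' : admissible Omega p h ->
  (forall c, h' <> h + const_mx c) ->
  potential h + dot (grad h) (h' - h) < potential h'.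
Proof.
move=> Hh ne.
have [i [x [Ox xi xh']]] : exists i x, [/\ Omega x, strict_cell p h i x &
    dot x (p i) + h' 0 i < max_affine p h' x].
  apply: contrapT => noix.
  have [|c] := @common_cells h h' Hh; last exact: ne.
  move=> i x Ox xi; apply/cellP/le_anti; rewrite le_max_affine andbT leNgt.
  by apply/negP => xh'; apply: noix; exists i, x.
suff : 0 < potential h' - potential h - dot (grad h) (h' - h) by lra.
pose U := strict_cell p h i `&`
  [set y | dot y (p i) + h' 0 i < max_affine p h' y].
have oU : open U.
  apply: openI; first exact: strict_cell_open.
  rewrite (_ : [set y | _] = (fun y => max_affine p h' y
      - (dot y (p i) + h' 0 i)) @^-1` [set z | 0 < z]).
    apply: open_comp; last exact: open_gt.
    move=> y _.
    exact: (cvgB (@max_affine_continuous _ _ _ p h' y)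
                 (@affine_continuous _ _ _ _ y)).
  by apply/seteqP; split=> y /=; rewrite subr_gt0.
rewrite potential_gap.
apply: (@ae_Rintegral_gt0 _ _ _ mu Omega (U `&` Omega)) => //.
- exact: integrable_gap.
- apply: filterS (ae_gap_ge0 h h') => y gy Oy.
  by rewrite mulr_ge0 // ltW // sigma_gt0.
- by apply: measurableI => //; exact: open_measurable_rV.
- exact: open_meets_gt0 oU _ Ox.
- apply: aeW => y [[yi yh'] Oy]; rewrite mulr_gt0 ?sigma_gt0 //.
  by rewrite (gap_strict_cell h' yi) subr_gt0.
Qed.

(** * Heights that fit the prescribed masses *)
Variable A : 'I_k.+1 -> R.
Hypothesis A_gt0 : forall i, 0 < A i.
Hypothesis sumA : \sum_i A i = \int[mu]_(x in Omega) sigma x.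

Local Notation fits := (fits_masses Omega sigma p A).
Let Arow : 'rV[R]_k.+1 := \row_i A i.

(** Up to an affine change, this is minus the objective of the Kantorovich dual
    of the transport problem. *)
Definition dual_functional h : R := potential h - \sum_i h 0 i * A i.
Local Notation dual := dual_functional.

Let dualE h : dual h = potential h - dot Arow h.
Proof. by congr (_ - _); apply: eq_bigr => i _; rewrite mxE mulrC. Qed.

Lemma dual_subgradient h h' :
  dual h + dot (grad h - Arow) (h' - h) <= dual h'.
Proof.
have := potential_subgradient h h'.
rewrite !dualE dotBl (dotBr _ _ Arow); lra.
Qed.

Lemma dual_strict_subgradient h h' : admissible Omega p h ->
  (forall c, h' <> h + const_mx c) ->
  dual h + dot (grad h - Arow) (h' - h) < dual h'.
Proof.
move=> Hh ne; have := potential_strict_subgradient Hh ne.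
rewrite !dualE dotBl (dotBr _ _ Arow); lra.
Qed.

Lemma fitsP b : fits b <-> grad b = Arow.
Proof.
split=> [fb|/rowP fb i]; first by apply/rowP => i; rewrite !mxE; exact: fb.
by have := fb i; rewrite !mxE.
Qed.

Lemma fits_dual_min b h : fits b -> dual b <= dual h.
Proof.
move=> /fitsP fb; have := dual_subgradient b h.
by rewrite fb subrr dot0l addr0.
Qed.

Lemma fits_admissible b : fits b -> admissible Omega p b.
Proof.
move=> fb i; rewrite lt_neqAle measure_ge0 andbT; apply/eqP => m0.
have := A_gt0 i.
rewrite -(fb i) /cell_mass /Rintegral null_set_integral ?ltxx //.
- by apply: measurableI => //; exact: measurable_cell.
- case/integrableP: integrable_sigma => + _; apply: measurable_funS => //.
Qed.

(** With e_i the i-th basis vector, the subgradient inequality based at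
    b + s e_i and minimality at b give s (A_i - m_i (b + s e_i)) <= 0 for small
    s of either sign; let s tend to 0. *)
Lemma local_min_fits b : (\forall h \near b, dual b <= dual h) -> fits b.
Proof.
move=> bmin i.
pose d : 'rV[R]_k.+1 := delta_mx 0 i.
pose w (s : R) : 'rV[R]_k.+1 := b + s *: d.
have w0 : w s @[s --> (0 : R)] --> b.
  have : w s @[s --> (0 : R)] --> b + (0 : R) *: d.
    by apply: cvgD; [exact: cvg_cst|apply: cvgZr_tmp; exact: cvg_id].
  by rewrite scale0r addr0.
have near0 : \forall s \near (0 : R), s * (A i - mass (w s) i) <= 0.
  have : \forall s \near (0 : R), dual b <= dual (w s) by exact: (w0 _ bmin).
  apply: filterS => s bs; have := dual_subgradient (w s) b.
  have -> : b - w s = (- s) *: d by rewrite /w opprD addrA subrr add0r scaleNr.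
  rewrite dotZr dotC dot_delta !mxE; move: bs; lra.
have wm : mass (w s) i @[s --> (0 : R)] --> mass b i.
  exact: (continuous_cvg _ (@cell_mass_continuous i b) w0).
have [lt_|gt_|//] := ltgtP (mass b i) (A i).
- have wmr : mass (w s) i @[s --> (0 : R)^'+] --> mass b i.
    exact: cvg_at_right_filter.
  have [s [s0 [H1 H2]]] : exists s : R, 0 < s /\
      (s * (A i - mass (w s) i) <= 0 /\ mass (w s) i < A i).
    apply: (@filter_ex _ (at_right (0 : R)) _).
    near=> s; split; first by near: s; exact: nbhs_right_gt.
    split; near: s; last exact: (cvgr_lt _ wmr).
    exact: cvg_within near0.
  by move: H1; rewrite pmulr_rle0 // subr_le0 leNgt H2.
- have wml : mass (w s) i @[s --> (0 : R)^'-] --> mass b i.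
    exact: cvg_at_left_filter.
  have [s [s0 [H1 H2]]] : exists s : R, s < 0 /\
      (s * (A i - mass (w s) i) <= 0 /\ A i < mass (w s) i).
    apply: (@filter_ex _ (at_left (0 : R)) _).
    near=> s; split; first by near: s; exact: nbhs_left_lt.
    split; near: s; last exact: (cvgr_gt _ wml).
    exact: cvg_within near0.
  by move: H1; rewrite nmulr_rle0 // subr_ge0 leNgt H2.
Unshelve. all: by end_near. Qed.

Lemma potential_continuous : continuous potential.
Proof.
move=> h.
have sub0 : h' - h @[h' --> h] --> (0 : 'rV[R]_k.+1).
  by have := cvgB (@cvg_id _ (nbhs h)) (cvg_cst h); rewrite subrr; exact.
have lower : potential h + dot (grad h) (h' - h) @[h' --> h] -->
    potential h + dot (grad h) 0.
  exact: (cvgD (cvg_cst _) (dot_cvg (cvg_cst _) sub0)).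
have upper : potential h + dot (grad h') (h' - h) @[h' --> h] -->
    potential h + dot (grad h) 0.
  exact: (cvgD (cvg_cst _) (dot_cvg (@grad_continuous h) sub0)).
rewrite dot0r addr0 in lower upper.
apply: squeeze_cvgr lower upper; apply: nearW => h' /=.
rewrite potential_subgradient /=; have := potential_subgradient h' h.
by rewrite !dotBr; lra.
Qed.

Lemma dual_continuous : continuous dual.
Proof.
move=> h; rewrite (_ : dual = fun h => potential h - dot h Arow); last first.
  by apply/funext => h'; rewrite dualE dotC.
exact: (cvgB (@potential_continuous h) (@dot_continuous _ _ Arow h)).
Qed.

Lemma max_affine_shift h x (c : R) :
  max_affine p (h + const_mx c) x = max_affine p h x + c.
Proof.
have [i xi] := cell_cover p h x; rewrite (cellP p h i x).1 // (cellP p _ i x).1.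
  by rewrite !mxE addrA.
by move=> j; rewrite !mxE; have := xi j; lra.
Qed.

Lemma dual_shift h (c : R) : dual (h + const_mx c) = dual h.
Proof.
rewrite /dual /potential; under eq_Rintegral do rewrite max_affine_shift mulrDl.
rewrite RintegralD //; [|exact: int_max|]; last first.
  exact: (integrableZl mO c integrable_sigma).
rewrite RintegralZl //; last exact: integrable_sigma.
rewrite -sumA mulr_sumr.
under [X in _ - X]eq_bigr do rewrite !mxE mulrDl.
rewrite big_split /=; lra.
Qed.

Let ray i : R := \int[mu]_(x in Omega) (dot x (p i) * sigma x).

(** Bounding u_h from below by its i-th affine function alone; the [ray i] are
    independent of h.  When h_i is the maximum, all the terms of the sum are
    nonnegative. *)
Lemma dual_lower_bound h i : ray i + \sum_j A j * (h 0 i - h 0 j) <= dual h.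
Proof.
have -> : \sum_j A j * (h 0 i - h 0 j) =
    h 0 i * (\sum_j A j) - \sum_j h 0 j * A j.
  by rewrite mulr_sumr -sumrB; apply: eq_bigr => j _; ring.
rewrite /dual addrA lerD2r sumA.
have intp : mu.-integrable Omega (EFin \o ((fun x => dot x (p i)) \* sigma)).
  by apply: integrable_density; exact: dot_continuous.
rewrite -RintegralZl //; last exact: integrable_sigma.
rewrite -RintegralD //; last exact: (integrableZl mO (h 0 i) integrable_sigma).
apply: le_Rintegral => //.
- have := integrableD mO intp (integrableZl mO (h 0 i) integrable_sigma).
  exact: eq_integrable.
- exact: int_max.
- by move=> x Ox; rewrite -mulrDl ler_wpM2r ?le_max_affine // ltW // sigma_gt0.
Qed.

(** Subtracting the minimum of h, one may assume that it is 0.  If then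
    max h <= L, the point is in the cube, where the minimum b was taken; if not,
    the lower bound exceeds the value at 0, which is in the cube. *)
Lemma exists_dual_min : exists b, forall h, dual b <= dual h.
Proof.
have [i0 _ A_min] := @arg_minP _ _ _ (0 : 'I_k.+1) predT A erefl.
pose C := \sum_i `|ray i|.
have C_ray i : - C <= ray i.
  have : `|ray i| <= C by rewrite /C (bigD1 i) //= lerDl sumr_ge0.
  by rewrite ler_norml => /andP[].
(* With this side, [dual_lower_bound] gives dual h >= |dual 0| whenever
   max h - min h > L, as C bounds the constants and A i0 is the least mass. *)
pose L := (`|dual 0| + C) / A i0.
have L0 : 0 <= L.
  by rewrite /L divr_ge0 ?(ltW (A_gt0 _)) // addr_ge0 // sumr_ge0.
pose K := [set h : 'rV[R]_k.+1 | forall i, h 0 i \in `[0, L]].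
have K0 : K 0 by move=> i; rewrite mxE in_itv /= lexx L0.
have cK : compact K.
  apply: (@rV_compact _ _ (fun=> [set` `[0, L]])) => i.
  exact: segment_compact.
have [b _ bmin] := @EVT_min_rV R _ dual K (ex_intro _ 0 K0) cK
  (continuous_subspaceT dual_continuous).
exists b => h.
have [l _ h_min] := @arg_minP _ _ _ (0 : 'I_k.+1) predT (fun i => h 0 i) erefl.
have [i _ h_max] := @arg_maxP _ _ _ (0 : 'I_k.+1) predT (fun i => h 0 i) erefl.
rewrite -(dual_shift h (- h 0 l)).
have [hL|hL] := leP (h 0 i - h 0 l) L.
  apply: bmin; rewrite inE => j; rewrite !mxE in_itv /=.
  rewrite subr_ge0 (h_min j) //=; apply: le_trans hL.
  by rewrite lerD2r; exact: h_max.
apply: (@le_trans _ _ (dual 0)); first by apply: bmin; rewrite inE.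
rewrite dual_shift; apply: le_trans (dual_lower_bound h i).
have : A i0 * L <= \sum_j A j * (h 0 i - h 0 j).
  rewrite (bigD1 l) //=; apply: (@le_trans _ _ (A l * (h 0 i - h 0 l))).
    by apply: ler_pM; [exact: ltW (A_gt0 _)| |exact: A_min|exact: ltW].
  rewrite lerDl sumr_ge0 // => j _.
  rewrite mulr_ge0 ?(ltW (A_gt0 _)) // subr_ge0.
  exact: h_max.
rewrite /L mulrC divfK ?gt_eqF //.
by have := C_ray i; have := ler_norm (dual 0); lra.
Qed.

Lemma exists_fits : exists b, fits b.
Proof.
have [b bmin] := exists_dual_min; exists b.
have bnear : \forall h \near b, dual b <= dual h by exact: filterE.
exact: local_min_fits.
Qed.

Lemma fits_shift b (c : R) : fits b -> fits (b + const_mx c).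
Proof.
move=> fb i; rewrite -(fb i) /cell_mass; congr (Rintegral _ (_ `&` _) _).
by apply/seteqP; split=> x xi j; have := xi j; rewrite !mxE; lra.
Qed.

Lemma fits_unique b b' : fits b -> fits b' -> exists c : R, b' = b + const_mx c.
Proof.
move=> fb fb'; apply: contrapT => /forallNP ne.
have := dual_strict_subgradient (fits_admissible fb) ne.
rewrite (fitsP b).1 // subrr dot0l addr0.
by rewrite ltNge fits_dual_min.
Qed.

Lemma dual_convex h h' (t : R) : 0 <= t <= 1 ->
  dual (t *: h + (1 - t) *: h') <= t * dual h + (1 - t) * dual h'.
Proof.
move=> /andP[t0 t1]; set z := t *: h + _.
have := dual_subgradient z h; have := dual_subgradient z h'.
have -> : h - z = (1 - t) *: (h - h').
  by apply/rowP => i; rewrite /z !mxE; ring.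
have -> : h' - z = (- t) *: (h - h').
  by apply/rowP => i; rewrite /z !mxE; ring.
rewrite !dotZr; set D := dot _ _ => H' H.
have := ler_wpM2l t0 H.
have : (1 - t) * (dual z + - t * D) <= (1 - t) * dual h'.
  by apply: ler_wpM2l => //; rewrite subr_ge0.
lra.
Qed.

Lemma dual_strictly_convex h h' (t : R) : 0 < t -> t < 1 ->
  admissible Omega p h -> admissible Omega p h' ->
  (forall c, h <> h' + const_mx c) ->
  dual (t *: h + (1 - t) *: h') < t * dual h + (1 - t) * dual h'.
Proof.
move=> t0 t1 Hh Hh' ne; set z := t *: h + _.
have Hz : admissible Omega p z by apply: admissible_comb => //; exact: ltW.
have hz : h - z = (1 - t) *: (h - h').
  by apply/rowP => i; rewrite /z !mxE; ring.
have h'z : h' - z = (- t) *: (h - h').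
  by apply/rowP => i; rewrite /z !mxE; ring.
have H : dual z + dot (grad z - Arow) (h - z) < dual h.
  apply: dual_strict_subgradient => // c hc; apply: (ne (c / (1 - t))).
  apply/eqP; rewrite addrC -subr_eq; apply/eqP.
  have : h - z = const_mx c by rewrite hc addrAC subrr add0r.
  rewrite hz => /(congr1 (fun v => (1 - t)^-1 *: v)).
  rewrite scalerA mulVf ?scale1r; last by rewrite subr_eq0 gt_eqF.
  by move=> ->; apply/rowP => i; rewrite !mxE mulrC.
have H' := dual_subgradient z h'.
move: H H'; rewrite hz h'z !dotZr; set D := dot _ _ => H H'.
have : t * (dual z + (1 - t) * D) < t * dual h by rewrite ltr_pM2l.
have : (1 - t) * (dual z + - t * D) <= (1 - t) * dual h'.
  by apply: ler_wpM2l => //; rewrite subr_ge0 ltW.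
lra.
Qed.

Lemma energyE a h : energy Omega sigma p A a h = dual h - potential a.
Proof.
rewrite /energy (@line_integral_mass_form setT a h).
  by rewrite /dual; lra.
have dseg (t : R) : is_derive t 1 (segment_path a h) (h - a).
  have seg_lim : s^-1 *: (segment_path a h (s *: 1 + t) - segment_path a h t)
      @[s --> (0 : R)^'] --> h - a.
    apply: cvg_near_cst; near=> s.
    have s0 : s != 0 by near: s; exact: nbhs_dnbhs_neq.
    rewrite /segment_path opprD addrACA subrr add0r -scalerBl addrK scalerA.
    by rewrite [s *: 1]mulr1 mulVf ?scale1r.
  apply: DeriveDef; first by apply/cvg_ex; exists (h - a).
  by rewrite /derive; exact: cvg_lim.
have dE : derive1 (segment_path a h) = cst (h - a).
  by apply/funext => t; rewrite derive1E; exact: derive_val.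
split.
- by rewrite /segment_path scale0r addr0.
- by rewrite /segment_path scale1r addrC subrK.
- by move=> t _; split=> //; exact: ex_derive.
- by rewrite dE; apply: continuous_subspaceT => t; exact: cvg_cst.
Unshelve. all: by end_near. Qed.

(** * Optimality of the gradient map *)
Local Notation cost := (quadratic_cost Omega sigma).
Local Notation transport := (transport_map Omega sigma p A).

Let preim (T : 'rV[R]_n -> 'rV[R]_n) (B : set 'rV[R]_n) := Omega `&` T @^-1` B.

Let preim_int T B : measurable (preim T B) ->
  (\int[mu]_(x in preim T B) (sigma x)%:E =
   (\int[mu]_(x in Omega) (\1_(preim T B) x * sigma x))%:E)%E.
Proof.
move=> mT; rewrite -Rintegral_setI_indic setIidl; last by move=> x [].
rewrite fineK //; apply: integrable_fin_num => //.
by apply: integrableS integrable_sigma => // x [].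
Qed.

Lemma gradient_transport b : fits b -> transport (gradient (max_affine p b)).
Proof.
move=> fb; set T := gradient _.
have mT : measurable_fun Omega T.
  by apply: measurable_funTS; exact: measurable_gradient_max_affine.
split=> // B mB.
rewrite [LHS](_ : _ = \int[mu]_(x in preim T B) (sigma x)%:E)%E //.
rewrite preim_int; last exact: mT.
have -> : (\sum_i (A i)%:E * \d_(p i) B = (\sum_i A i * (p i \in B)%:R)%:E)%E.
  by rewrite -sumEFin; apply: eq_bigr => i _; rewrite diracE EFinM.
congr EFin.
transitivity (\int[mu]_(x in Omega)
    \sum_i (\1_(cell p b i) x * (p i \in B)%:R) * sigma x); last first.
  rewrite Rintegral_sum //; last by move=> i; exact: integrable_cell_density.
  apply: eq_bigr => i _; rewrite -(fb i) cell_massE -RintegralZr //.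
    by apply: eq_Rintegral => x _; ring.
  exact: integrable_indicM mO (measurable_cell p b i) integrable_sigma.
apply: ae_eq_Rintegral => //.
- apply: integrable_indicM => //; [exact: mT|exact: integrable_sigma].
- have := int_cells b (\row_i (p i \in B)%:R).
  apply: eq_integrable => // x _ /=; congr EFin.
  by apply: eq_bigr => i _; rewrite mxE.
apply: filterS (ae_strict_cell p_inj b) => x [i xi] Ox.
rewrite (bigD1 i) //= big1 ?addr0 => [|j ji].
  rewrite (indic_strict_cell _ xi) eqxx mul1r indicE.
  congr ((nat_of_bool _)%:R * _); apply/idP/idP;
    rewrite !inE /preim /= /T (gradient_strict_cell xi); last by split.
  by case.
by rewrite (indic_strict_cell _ xi) (negbTE ji) !mul0r.
Qed.

Section cost_lower_bound.
Variable b : 'rV[R]_k.+1.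

(** sigma x (|x|^2 - 2 u_b x + |p_i|^2 + 2 b_i) where T x = p_i, written with
    indicators so that its integral can be read off from the masses of the
    preimages of the p_i. *)
Definition cost_minorant (T : 'rV[R]_n -> 'rV[R]_n) x : R :=
  (sqnorm x - 2 * max_affine p b x) * sigma x
  + \sum_i (sqnorm (p i) + 2 * b 0 i) * (\1_(preim T [set p i]) x * sigma x).

Lemma sqnormB x y : sqnorm (x - y) = sqnorm x - 2 * dot x y + sqnorm y.
Proof. by rewrite /sqnorm dotBl !dotBr (dotC y x); ring. Qed.

Lemma cost_minorantE T x i : Omega x -> T x = p i ->
  sqnorm (x - T x) * sigma x - cost_minorant T x =
  2 * (max_affine p b x - (dot x (p i) + b 0 i)) * sigma x.
Proof.
move=> Ox Tx; rewrite /cost_minorant Tx sqnormB (bigD1 i) //= big1 => [|j ji].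
  by rewrite indicE mem_set ?mul1r //; ring.
rewrite indicE memNset ?mul0r ?mulr0 // => -[_ /=]; rewrite Tx => /p_inj ij.
by move: ji; rewrite ij eqxx.
Qed.

Let mset1 (y : 'rV[R]_n) : measurable [set y].
Proof.
apply: closed_measurable_rV; apply: accessible_closed_set1.
by apply: hausdorff_accessible; exact: norm_hausdorff.
Qed.

Let int_preim T i : transport T ->
  mu.-integrable Omega (EFin \o (\1_(preim T [set p i]) \* sigma)).
Proof.
by move=> [mT _]; apply: integrable_indicM => //;
  [exact: mT|exact: integrable_sigma].
Qed.

Let int_smooth : mu.-integrable Omega
  (EFin \o ((fun x => sqnorm x - 2 * max_affine p b x) \* sigma)).
Proof.
apply: integrable_density => x.
exact: (cvgB (@sqnorm_continuous _ _ x)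
             (cvgMl_tmp (@max_affine_continuous _ _ _ p b x))).
Qed.

Let int_atom T i : transport T -> mu.-integrable Omega
  (EFin \o (fun x =>
    (sqnorm (p i) + 2 * b 0 i) * (\1_(preim T [set p i]) x * sigma x))).
Proof.
move=> tT; have := integrableZl mO (sqnorm (p i) + 2 * b 0 i) (int_preim i tT).
exact: eq_integrable.
Qed.

Let int_atoms T : transport T -> mu.-integrable Omega (EFin \o (fun x =>
  \sum_i (sqnorm (p i) + 2 * b 0 i) * (\1_(preim T [set p i]) x * sigma x))).
Proof.
move=> tT; rewrite (_ : _ \o _ = fun x => (\sum_i
  ((sqnorm (p i) + 2 * b 0 i) * (\1_(preim T [set p i]) x * sigma x))%:E)%E).
  by apply: integrable_sum => // i _; exact: int_atom.
by apply/funext => x /=; rewrite sumEFin.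
Qed.

Lemma integrable_cost_minorant T : transport T ->
  mu.-integrable Omega (EFin \o cost_minorant T).
Proof.
move=> tT; have := integrableD mO int_smooth (int_atoms tT).
exact: eq_integrable.
Qed.

Lemma Rintegral_cost_minorant T : transport T ->
  \int[mu]_(x in Omega) cost_minorant T x =
  \int[mu]_(x in Omega) ((sqnorm x - 2 * max_affine p b x) * sigma x)
  + \sum_i (sqnorm (p i) + 2 * b 0 i) * A i.
Proof.
move=> tT; rewrite (RintegralD mO int_smooth (int_atoms tT)); congr (_ + _).
rewrite Rintegral_sum //; last by move=> i; exact: int_atom.
apply: eq_bigr => i _; rewrite RintegralZl //; last exact: int_preim.
congr (_ * _); apply: EFin_inj; rewrite -preim_int; last exact: tT.1.
rewrite [LHS](tT.2 [set p i]) // (bigD1 i) //= big1 ?adde0 => [|j ji].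
  by rewrite diracE mem_set ?mule1.
rewrite diracE memNset ?mule0 // => /= /p_inj ij.
by move: ji; rewrite ij eqxx.
Qed.

(** The push-forward gives no mass to the complement of the p_i, and sigma is
    positive. *)
Lemma transport_range T : transport T ->
  {ae mu, forall x, Omega x -> exists i, T x = p i}.
Proof.
move=> [mT pushT]; pose B := ~` (\bigcup_(i in [set: 'I_k.+1]) [set p i]).
have mB : measurable B by apply: measurableC; exact: fin_bigcup_measurable.
have mTB : measurable (preim T B) by exact: mT.
have int0 : (\int[mu]_(x in preim T B) (sigma x)%:E = 0)%E.
  rewrite [LHS](pushT B mB) big1 // => i _.
  by rewrite diracE memNset ?mule0 //; apply; exists i.
have ms : measurable_fun (preim T B) (EFin \o sigma).
  case/integrableP: integrable_sigma => + _; apply: measurable_funS => //.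
  by move=> x [].
have [+ _] := ae_eq_integral_abs mu mTB ms.
case=> [|N [mN N0 sN]].
  rewrite -int0; apply: eq_integral => x /[!inE] -[Ox _] /=.
  by rewrite gtr0_norm // sigma_gt0.
exists N; split=> // x /= /not_implyP[Ox nT]; apply: sN => /= sx0.
have : (sigma x)%:E = 0%E.
  by apply: sx0; split=> // -[i _ Tx]; apply: nT; exists i.
by case=> s0; have := sigma_gt0 Ox; rewrite s0 ltxx.
Qed.

Lemma measurable_cost T : transport T -> measurable_fun Omega
  (fun x => sqnorm (x - T x) * sigma x : measurableTypeR R).
Proof.
move=> [mT _]; apply: measurable_funM; last first.
  exact: within_continuous_measurable_fun_rV.
rewrite /sqnorm /dot; apply: measurable_sum => i.
have mTi : measurable_fun Omega (fun x => x 0 i - T x 0 i : measurableTypeR R).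
  apply: measurable_funB.
    by apply: measurable_funTS; exact: measurable_coord.
  exact: (measurableT_comp (measurable_coord i) mT).
by under eq_fun do rewrite !mxE; exact: measurable_funM.
Qed.

Lemma cost_ge T : transport T ->
  ((\int[mu]_(x in Omega) cost_minorant T x)%:E <= cost T)%E.
Proof.
move=> tT.
have cost_ge0 x : Omega x -> 0 <= sqnorm (x - T x) * sigma x.
  move=> Ox; rewrite mulr_ge0 ?(ltW (sigma_gt0 Ox)) // sumr_ge0 // => i _.
  by rewrite -expr2 sqr_ge0.
have [cT|cT] := eqVneq (cost T) +oo%E; first by rewrite cT leey.
have intc : mu.-integrable Omega
    (EFin \o (fun x => sqnorm (x - T x) * sigma x)).
  apply/integrableP; split.
    by apply/measurable_EFinP; exact: measurable_cost.
  rewrite ltey; apply: contra cT => /eqP cT; apply/eqP; rewrite -cT.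
  by apply: eq_integral => x /[!inE] Ox /=; rewrite ger0_norm // cost_ge0.
rewrite -[leRHS]fineK; last exact: integrable_fin_num intc.
rewrite lee_fin -subr_ge0.
rewrite -(RintegralB mO intc (integrable_cost_minorant tT)).
apply: ae_Rintegral_ge0 => //.
  have := integrableB mO intc (integrable_cost_minorant tT).
  exact: eq_integrable.
apply: filterS (transport_range tT) => x Tx Ox; have [i Txi] := Tx Ox.
rewrite (cost_minorantE Ox Txi) mulr_ge0 ?(ltW (sigma_gt0 Ox)) //.
by rewrite mulr_ge0 // subr_ge0 le_max_affine.
Qed.

End cost_lower_bound.

Lemma gradient_cost b : fits b ->
  cost (gradient (max_affine p b)) =
  (\int[mu]_(x in Omega) cost_minorant b (gradient (max_affine p b)) x)%:E%E.
Proof.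
move=> fb; have tb := gradient_transport fb.
rewrite /cost /Rintegral fineK; last first.
  by apply: integrable_fin_num => //; exact: integrable_cost_minorant.
apply: ae_eq_integral => //.
- by apply/measurable_EFinP; exact: measurable_cost.
- by case/integrableP: (integrable_cost_minorant b tb).
- apply: filterS (ae_strict_cell p_inj b) => x [i xi] Ox; congr EFin.
  apply/eqP; rewrite -subr_eq0 (cost_minorantE b Ox (gradient_strict_cell xi)).
  by rewrite (cellP p b i x).1 ?subrr ?mulr0 ?mul0r //; exact: strict_cellW.
Qed.

Lemma gradient_optimal b T : fits b -> transport T ->
  (cost (gradient (max_affine p b)) <= cost T)%E.
Proof.
move=> fb tT; rewrite gradient_cost //.
rewrite (Rintegral_cost_minorant b (gradient_transport fb)).
by rewrite -(Rintegral_cost_minorant b tT); exact: cost_ge.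
Qed.

End potential.

(** * The theorem *)
Theorem theorem1p2 (R : realType) (n k : nat)
    (Omega : set 'rV[R]_n) (sigma : 'rV[R]_n -> R)
    (p : 'I_k.+1 -> 'rV[R]_n) (A : 'I_k.+1 -> R) :
  compact Omega -> convex_set Omega -> Omega° !=set0 ->
  injective p ->
  {within Omega, continuous sigma} -> (forall x, Omega x -> 0 < sigma x) ->
  (forall i, 0 < A i) ->
  \sum_i A i = \int[lebesgue_rV n]_(x in Omega) sigma x ->
  let H := admissible Omega p in
  let E := energy Omega sigma p A in
  [/\ exists2 b, fits_masses Omega sigma p A b &
        forall b', fits_masses Omega sigma p A b' <->
                   exists c : R, b' = b + const_mx c,
      [/\ open H, convex_set H &
        forall a, H a ->
        [/\ forall h g, C1_path_in H a h g ->
              E a h = line_integral (mass_form Omega sigma p) g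
                      - \sum_i h 0 i * A i,
            convex_function H (E a) &
            forall b, fits_masses Omega sigma p A b <->
                      H b /\ forall h, H h -> E a b <= E a h]],
      forall a, H a ->
        strictly_convex_function (H `&` [set h : 'rV[R]_k.+1 | \sum_i h 0 i = 0]) (E a) &
      forall b, fits_masses Omega sigma p A b ->
        [/\ {ae lebesgue_rV n, forall x, Omega x ->
               differentiable (max_affine p b) x},
            transport_map Omega sigma p A (gradient (max_affine p b)) &
            forall T, transport_map Omega sigma p A T ->
              (quadratic_cost Omega sigma (gradient (max_affine p b)) <=
               quadratic_cost Omega sigma T)%E]].
Proof.
move=> cO convO intO p_inj csigma sigma_gt0 A_gt0 sumA H E.
have energy_dual a h : E a h =
    dual_functional Omega sigma p A h - potential Omega sigma p a.
  exact: energyE.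
have fitsH b : fits_masses Omega sigma p A b -> H b.
  exact: fits_admissible.
split.
- have [b fb] : exists b, fits_masses Omega sigma p A b by exact: exists_fits.
  exists b => // b'; split=> [fb'|[c ->]]; last exact: fits_shift.
  by apply: fits_unique fb fb'.
- split; [exact: admissible_open|exact: admissible_convex|].
  move=> a Ha; split.
  + move=> h g gC1.
    rewrite energy_dual (line_integral_mass_form _ _ _ _ gC1) //.
    by rewrite /dual_functional; ring.
  + move=> t x y _ _; rewrite !energy_dual.
    have t01 : 0 <= t%:num <= 1 by apply/andP; split; [exact: ge0|exact: le1].
    have := dual_convex cO p_inj csigma sigma_gt0 A x y t01.
    rewrite convRE /unstable.onem /=; set z := conv t x y.
    rewrite (_ : t%:num *: x + _ = z) //; lra.
  + move=> b; split=> [fb|[Hb bmin]].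
      split=> [|h Hh]; first exact: fitsH.
      by rewrite !energy_dual lerD2r; exact: fits_dual_min.
    apply: local_min_fits => //.
    have : \forall h \near b, H h.
      by apply: open_nbhs_nbhs; split=> //; exact: admissible_open.
    by apply: filterS => h /bmin; rewrite !energy_dual lerD2r.
- move=> a Ha t t0 t1 x y /[!inE] -[Hx x0] [Hy y0] xy; rewrite !energy_dual.
  have ne c : x <> y + const_mx c.
    move=> xyc; move: x0; rewrite /= xyc.
    under eq_bigr do rewrite !mxE.
    rewrite big_split /= y0 add0r sumr_const card_ord => /eqP.
    rewrite mulrn_eq0 /= => /eqP c0; move/eqP: xy; apply.
    by rewrite xyc c0; apply/rowP => i; rewrite !mxE addr0.
  have := dual_strictly_convex cO p_inj csigma sigma_gt0 convO intO A
    t0 t1 Hx Hy ne.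
  rewrite convRE /unstable.onem /=; set z := conv t x y.
  rewrite (_ : t%:num *: x + _ = z) //; lra.
- move=> b fb; split.
  + apply: filterS (ae_strict_cell p_inj b) => x [i xi] _.
    by have [] := max_affine_is_diff xi.
  + exact: gradient_transport.
  + by move=> T tT; exact: gradient_optimal.
Qed.
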